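(* There is a unique set $\{C_k:k\in\mathbb{Z}_{>0}\}$ of generators of $\Lambda$ (over $\mathbb{Z}[\alpha,\beta]$) satisfying, for every $k\ge1$, $C_k\in g^\beta_{(k)}+\sum_{i<k}\mathbb{Z}[\alpha>\beta]\,g^\beta_{(i)}$ and $\omega(\overline{C_k})\in g^\beta_{(1^k)}+\sum_{i<k}\mathbb{Z}[\alpha>\beta]\,g^\beta_{(1^i)}$. Moreover, $C_k=g^{(\alpha,\beta)}_{(k)}$ for all $k$.
   Context: Let $\alpha,\beta$ be indeterminates, $\Lambda$ the ring of symmetric functions over $\mathbb{Z}[\alpha,\beta]$, $\hat\Lambda$ its completion, $\langle\cdot,\cdot\rangle:\Lambda\times\hat\Lambda\to\mathbb{Z}[\alpha,\beta]$ the Hall inner product with $\langle s_\lambda,s_\mu\rangle=\delta_{\lambda\mu}$, and $\omega$ the involution with $\omega(s_\lambda)=s_{\lambda'}$. For parameters $(a,b)$, a partition $\lambda$ and $n\ge1$, $G^{(a,b)}_\lambda(x_1,\ldots,x_n)=\det\Big[\frac{x_i^{\lambda_j+n-j}(1+bx_i)^{j-1}}{(1-ax_i)^{\lambda_j}}\Big]_{1\le i,j\le n}\Big/\prod_{i<j}(x_i-x_j)$, stable under $x_{n+1}=0$, defining $G^{(a,b)}_\lambda\in\hat\Lambda$; $g^{(a,b)}_\lambda\in\Lambda$ is defined by $\langle g^{(a,b)}_\lambda,G^{(-a,-b)}_\mu\rangle=\delta_{\lambda\mu}$. Set $g^\beta_\lambda=g^{(0,\beta)}_\lambda$ (dual stable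 Grothendieck polynomials). For $p\in\mathbb{Z}[\alpha,\beta]$, $\bar p$ is obtained by interchanging $\alpha$ and $\beta$, and for $f=\sum_\lambda a_\lambda s_\lambda\in\Lambda$, $\overline f=\sum_\lambda\overline{a_\lambda}s_\lambda$. $\mathbb{Z}[\alpha>\beta]=\{\sum a_{ij}\alpha^i\beta^j: a_{ij}\in\mathbb{Z}, \text{ finite sum with } a_{ij}=0\text{ unless } j<i\}$. $(k)$ is the one-row and $(1^k)$ the one-column partition of size $k$. *)

(* Defs.v *)
From HB Require Import structures.
From Stdlib Require Import ClassicalEpsilon FunctionalExtensionality.
From Stdlib Require ProofIrrelevance.
From mathcomp Require Import all_boot all_order all_fingroup all_algebra.
From mathcomp Require Import finmap.
From mathcomp Require Import mpoly.
From mathcomp Require boolp.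

Set Implicit Arguments.
Unset Strict Implicit.
Unset Printing Implicit Defensive.

Import GRing.Theory.
Local Open Scope ring_scope.

Local Notation "x %:F" := (tofrac x) : ring_scope.

Definition is_part (s : seq nat) := sorted geq s && (0%N \notin s).

Record intpart := IntPart { parts :> seq nat; partsP : is_part parts }.

HB.instance Definition _ := [isSub for parts].
HB.instance Definition _ := [Choice of intpart by <:].

Lemma row_is_part k : is_part (nseq (0 < k) k).
Proof. by case: k. Qed.

Lemma col_is_part k : is_part (nseq k 1%N).
Proof.
rewrite /is_part mem_nseq andbF andbT.
by elim: k => // -[|k] //= ->.
Qed.

(* (k) and (1^k); both are the empty partition when k = 0. *)
Definition rowp k := IntPart (row_is_part k).
Definition colp k := IntPart (col_is_part k).

Definition conj_parts (s : seq nat) : seq nat :=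
  mkseq (fun i => count (fun x => i < x)%N s) (head 0%N s).

Lemma conj_is_part (p : intpart) : is_part (conj_parts p).
Proof.
rewrite /is_part /conj_parts; case: p => -[|x s] //= /andP[_ _].
apply/andP; split.
  rewrite /mkseq sorted_map.
  apply: (sub_sorted _ (iota_sorted 0 x)) => i j /= le_ij.
  rewrite leq_add // ?sub_count // => [|y lt_jy]; last exact: leq_ltn_trans lt_jy.
  by case: ltnP => // lt_jx; rewrite (leq_ltn_trans le_ij lt_jx).
by apply/mapP => -[i]; rewrite mem_iota add0n => /= lt_ix; rewrite lt_ix.
Qed.

Definition conjp (p : intpart) : intpart := IntPart (conj_is_part p).

Section SymFun.

Variable R : idomainType.

(* The substitution x_{n+1} = 0. *)
Definition restr n (p : {mpoly R[n.+1]}) : {mpoly R[n]} :=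
  p \mPo [tuple oapp (fun j : 'I_n => 'X_j) 0 (unlift ord_max i) | i < n.+1].

(* A symmetric function is a family of symmetric polynomials of bounded degree
   in n = 0, 1, 2, ... variables, compatible with x_{n+1} = 0. *)
Record symfun := SymFun {
  sf :> forall n, {mpoly R[n]};
  sf_sym : forall n, sf n \is symmetric;
  sf_stable : forall n, restr (sf n.+1) = sf n;
  sf_bounded : exists d, forall n, (msize (sf n) <= d)%N
}.

Lemma symfunP (f g : symfun) : (forall n, f n = g n) -> f = g.
Proof.
case: f g => [f f1 f2 f3] [g g1 g2 g3] /= fg.
have {}fg : f = g by apply: functional_extensionality_dep.
by subst g; congr SymFun; exact: ProofIrrelevance.proof_irrelevance.
Qed.

Lemma sf0_stable n : @restr n 0 = 0.
Proof. exact: raddf0. Qed.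

Lemma sf0_bounded : exists d, forall n, (msize (0 : {mpoly R[n]}) <= d)%N.
Proof. by exists 0%N => n; rewrite msize0. Qed.

Definition symfun0 :=
  SymFun (fun n => rpred0 _) sf0_stable sf0_bounded.

Lemma sf1_stable n : @restr n 1 = 1.
Proof. exact: rmorph1. Qed.

Lemma sf1_bounded : exists d, forall n, (msize (1 : {mpoly R[n]}) <= d)%N.
Proof. by exists 1%N => n; rewrite msize1. Qed.

Definition symfun1 :=
  SymFun (fun n => rpred1 _) sf1_stable sf1_bounded.

Section Ops.

Variables (c : R) (f g : symfun).

Lemma sfN_sym n : - f n \is symmetric.
Proof. by rewrite rpredN sf_sym. Qed.
Lemma sfN_stable n : restr (- f n.+1) = - f n.
Proof. by rewrite /restr raddfN /= [X in - X]sf_stable. Qed.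
Lemma sfN_bounded : exists d, forall n, (msize (- f n) <= d)%N.
Proof. by have [d fd] := sf_bounded f; exists d => n; rewrite msizeN. Qed.
Definition symfunN := SymFun sfN_sym sfN_stable sfN_bounded.

Lemma sfD_sym n : f n + g n \is symmetric.
Proof. by rewrite rpredD ?sf_sym. Qed.
Lemma sfD_stable n : restr (f n.+1 + g n.+1) = f n + g n.
Proof.
by rewrite /restr raddfD /= [X in X + _]sf_stable [X in _ + X]sf_stable.
Qed.
Lemma sfD_bounded : exists d, forall n, (msize (f n + g n) <= d)%N.
Proof.
have [d fd] := sf_bounded f; have [e ge] := sf_bounded g.
exists (maxn d e) => n; apply: leq_trans (msizeD_le _ _) _.
by rewrite geq_max !leq_max fd ge orbT.
Qed.
Definition symfunD := SymFun sfD_sym sfD_stable sfD_bounded.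

Lemma sfM_sym n : f n * g n \is symmetric.
Proof. by rewrite rpredM ?sf_sym. Qed.
Lemma sfM_stable n : restr (f n.+1 * g n.+1) = f n * g n.
Proof.
by rewrite /restr rmorphM /= [X in X * _]sf_stable [X in _ * X]sf_stable.
Qed.
Lemma sfM_bounded : exists d, forall n, (msize (f n * g n) <= d)%N.
Proof.
have [d fd] := sf_bounded f; have [e ge] := sf_bounded g.
exists (d + e)%N => n; have [->|nzf] := eqVneq (f n) 0.
  by rewrite mul0r msize0.
have [->|nzg] := eqVneq (g n) 0; first by rewrite mulr0 msize0.
by rewrite msizeM // (leq_trans (leq_pred _)) // leq_add.
Qed.
Definition symfunM := SymFun sfM_sym sfM_stable sfM_bounded.

Lemma sfZ_sym n : c *: f n \is symmetric.
Proof. by rewrite rpredZ ?sf_sym. Qed.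
Lemma sfZ_stable n : restr (c *: f n.+1) = c *: f n.
Proof. by rewrite /restr linearZ /= [X in _ *: X]sf_stable. Qed.
Lemma sfZ_bounded : exists d, forall n, (msize (c *: f n) <= d)%N.
Proof.
by have [d fd] := sf_bounded f; exists d => n; apply: leq_trans (msizeZ_le _ _) _.
Qed.
Definition symfunZ := SymFun sfZ_sym sfZ_stable sfZ_bounded.

End Ops.

HB.instance Definition _ := boolp.gen_eqMixin symfun.
HB.instance Definition _ := boolp.gen_choiceMixin symfun.

Fact symfun_addA : associative symfunD.
Proof. by move=> f g h; apply: symfunP => n /=; rewrite addrA. Qed.
Fact symfun_addC : commutative symfunD.
Proof. by move=> f g; apply: symfunP => n /=; rewrite addrC. Qed.
Fact symfun_add0 : left_id symfun0 symfunD.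
Proof. by move=> f; apply: symfunP => n /=; rewrite add0r. Qed.
Fact symfun_addN : left_inverse symfun0 symfunN symfunD.
Proof. by move=> f; apply: symfunP => n /=; rewrite addNr. Qed.

HB.instance Definition _ := GRing.isZmodule.Build symfun
  symfun_addA symfun_addC symfun_add0 symfun_addN.

Fact symfun_mulA : associative symfunM.
Proof. by move=> f g h; apply: symfunP => n /=; rewrite mulrA. Qed.
Fact symfun_mulC : commutative symfunM.
Proof. by move=> f g; apply: symfunP => n /=; rewrite mulrC. Qed.
Fact symfun_mul1 : left_id symfun1 symfunM.
Proof. by move=> f; apply: symfunP => n /=; rewrite mul1r. Qed.
Fact symfun_mulD : left_distributive symfunM symfunD.
Proof. by move=> f g h; apply: symfunP => n /=; rewrite mulrDl. Qed.
Fact symfun_nz : symfun1 != symfun0.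
Proof.
apply/eqP => /(congr1 (fun f : symfun => f 0%N)) /= /eqP.
by rewrite oner_eq0.
Qed.

HB.instance Definition _ := GRing.Zmodule_isComNzRing.Build symfun
  symfun_mulA symfun_mulC symfun_mul1 symfun_mulD symfun_nz.

Fact symfun_scaleA a b f : symfunZ a (symfunZ b f) = symfunZ (a * b) f.
Proof. by apply: symfunP => n /=; rewrite scalerA. Qed.
Fact symfun_scale1 : left_id 1 symfunZ.
Proof. by move=> f; apply: symfunP => n /=; rewrite scale1r. Qed.
Fact symfun_scaleDr : right_distributive symfunZ +%R.
Proof. by move=> a f g; apply: symfunP => n /=; rewrite scalerDr. Qed.
Fact symfun_scaleDl f : {morph symfunZ^~ f : a b / a + b}.
Proof. by move=> a b; apply: symfunP => n /=; rewrite scalerDl. Qed.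

HB.instance Definition _ := GRing.Zmodule_isLmodule.Build R symfun
  symfun_scaleA symfun_scale1 symfun_scaleDr symfun_scaleDl.

Fact symfun_scaleAl (a : R) (f g : symfun) : a *: (f * g) = a *: f * g.
Proof. by apply: symfunP => n /=; rewrite scalerAl. Qed.

HB.instance Definition _ := GRing.Lmodule_isLalgebra.Build R symfun
  symfun_scaleAl.

Fact symfun_scaleAr (a : R) (f g : symfun) : a *: (f * g) = f * (a *: g).
Proof. by apply: symfunP => n /=; rewrite scalerAr. Qed.

HB.instance Definition _ := GRing.Lalgebra_isAlgebra.Build R symfun
  symfun_scaleAr.

(* The family is C_1, C_2, ...; the value of C at 0 is irrelevant. *)
Definition generators (C : nat -> symfun) : Prop :=
  forall f : symfun, exists (N : nat) (P : {mpoly R[N]}),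
    f = mmap (in_alg symfun) (fun i : 'I_N => C i.+1) P.

(* Power series in n variables, as coefficient functions. *)
Definition mseries n := 'X_{1..n} -> R.

Record symser := SymSer {
  ss :> forall n, mseries n;
  ss_sym : forall n (s : 'S_n) (m : 'X_{1..n}),
    ss [multinom m (s i) | i < n] = ss m;
  ss_stable : forall n (m : 'X_{1..n}), ss (mnmwiden m) = ss m
}.

Lemma ss0_sym n (s : 'S_n) (m : 'X_{1..n}) :
  (fun=> 0 : R) [multinom m (s i) | i < n] = (fun=> 0) m.
Proof. by []. Qed.

Definition symser0 : symser :=
  @SymSer (fun n _ => 0) ss0_sym (fun n m => erefl).

(* F is the power series expansion of the rational function q: q = p / d where
   the constant term of d is 1, and d * F = p as power series. *)
Definition expansion n (q : {fraction {mpoly R[n]}}) (F : mseries n) : Prop :=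
  exists p d : {mpoly R[n]},
    [/\ d@_0%MM = 1, q = p%:F / d%:F &
        forall m, \sum_(k <- msupp d | (k <= m)%MM) d@_k * F (m - k)%MM = p@_m].

(* The indices i, j start at 0 here, so lambda_j is nth 0 lam j, the exponent
   n - j becomes n - j.+1 and the exponent j - 1 becomes j. *)
Definition Gfrac (a b : R) (lam : seq nat) n : {fraction {mpoly R[n]}} :=
  \det (\matrix_(i < n, j < n)
          ((('X_i ^+ (nth 0%N lam j + (n - j.+1)) *
             (1 + b *: 'X_i) ^+ j : {mpoly R[n]})%:F) /
           (((1 - a *: 'X_i) ^+ nth 0%N lam j : {mpoly R[n]})%:F)))
  / \prod_(i < n) \prod_(j < n | (i < j)%N) ('X_i - 'X_j : {mpoly R[n]})%:F.

(* The formula holds for at least (size lam) variables; the values in fewer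
   variables are then determined by stability. *)
Definition is_G (a b : R) (lam : intpart) (F : symser) : Prop :=
  forall n, (0 < n)%N -> (size lam <= n)%N -> expansion (Gfrac a b lam n) (F n).

Definition G (a b : R) (lam : intpart) : symser :=
  epsilon (inhabits symser0) (is_G a b lam).

Definition is_schur (lam : intpart) (f : symfun) : Prop :=
  forall n, (0 < n)%N -> (size lam <= n)%N ->
    (f n)%:F =
      \det (\matrix_(i < n, j < n)
              ('X_i ^+ (nth 0%N lam j + (n - j.+1)) : {mpoly R[n]})%:F)
      / \prod_(i < n) \prod_(j < n | (i < j)%N) ('X_i - 'X_j : {mpoly R[n]})%:F.

Definition schur (lam : intpart) : symfun :=
  epsilon (inhabits 0) (is_schur lam).

Definition schur_sum (c : {fsfun intpart -> R with 0}) : symfun :=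
  \sum_(lam <- finsupp c) c lam *: schur lam.

Definition schur_coord (f : symfun) : {fsfun intpart -> R with 0} :=
  epsilon (inhabits [fsfun]) (fun c => f = schur_sum c).

(* F = sum_lam b_lam s_lam in the completion: each coefficient of the partial
   sums is eventually equal to the one of F, along finite sets of partitions. *)
Definition schur_series (b : intpart -> R) (F : symser) : Prop :=
  forall n (m : 'X_{1..n}), exists S0 : {fset intpart},
    forall S : {fset intpart}, (S0 `<=` S)%fset ->
      \sum_(lam <- S) b lam * (schur lam n)@_m = F n m.

Definition schur_scoord (F : symser) : intpart -> R :=
  epsilon (inhabits (fun=> 0)) (fun b => schur_series b F).

Definition hall (f : symfun) (F : symser) : R :=
  \sum_(lam <- finsupp (schur_coord f))
     schur_coord f lam * schur_scoord F lam.

Definition omega (f : symfun) : symfun :=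
  \sum_(lam <- finsupp (schur_coord f))
     schur_coord f lam *: schur (conjp lam).

Definition is_g (a b : R) (lam : intpart) (g : symfun) : Prop :=
  forall mu : intpart, hall g (G (- a) (- b) mu) = (lam == mu)%:R.

Definition g (a b : R) (lam : intpart) : symfun :=
  epsilon (inhabits 0) (is_g a b lam).

End SymFun.

Arguments G {R}.
Arguments g {R}.

Notation Zab := {mpoly int[2]}.
Notation Lambda := (symfun Zab).

Definition al : Zab := 'X_(0 : 'I_2).
Definition be : Zab := 'X_(1 : 'I_2).

Definition swap (p : Zab) : Zab := p \mPo [tuple be; al].

(* Z[alpha > beta] *)
Definition al_gt_be (p : Zab) : Prop :=
  forall m : 'X_{1..2}, m \in msupp p -> (m (0 : 'I_2)%R > m (1 : 'I_2)%R)%N.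

Definition bar (f : Lambda) : Lambda :=
  \sum_(lam <- finsupp (schur_coord f))
     swap (schur_coord f lam) *: schur Zab lam.

Definition gbeta (lam : intpart) : Lambda := g 0 be lam.

(* f lies in u_k + sum_(i < k) Z[alpha > beta] u_i *)
Definition unitri (u : nat -> Lambda) (k : nat) (f : Lambda) : Prop :=
  exists q : nat -> Zab, (forall i, (i < k)%N -> al_gt_be (q i)) /\
    f = u k + \sum_(i < k) q i *: u i.

Definition canonical_generators (C : nat -> Lambda) : Prop :=
  generators C /\
  forall k, (0 < k)%N ->
    unitri (fun i => gbeta (rowp i)) k (C k) /\
    unitri (fun i => gbeta (colp i)) k (omega (bar (C k))).

(* Main.v *)
Require Import Defs.
From HB Require Import structures.
From Stdlib Require Import ClassicalEpsilon.
From mathcomp Require Import all_boot all_order all_fingroup all_algebra.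
From mathcomp Require Import finmap mpoly.
From mathcomp Require Import zify.
From mathcomp.algebra_tactics Require Import ring.

(** Extracting the coefficient of s_lambda from F amounts to reading the
    coefficient of x^(lambda + delta) in the product of F and the Vandermonde
    determinant. For F = G_mu this is a determinant of coefficients of univariate
    power series, which vanishes unless mu is contained in lambda; hence the dual
    functions g are unique. On one row and one column (k >= 1) the determinants
    collapse, and give

      g^(a,b)_(k)   = sum_i binomial(k - 1, k - i) a^(k - i) h_i,
      g^(0,b)_(1^k) = sum_i binomial(k - 1, k - i) b^(k - i) e_i.

    So g^(alpha,beta)_(k) is unitriangular in the h_i = g^beta_(i), and omega of
    its conjugate is exactly g^beta_(1^k). If C_k is another solution, write the
    difference as sum_(i < k) d_i h_i; comparing top coefficients after omega and
    the bar involution, d_i and its swap both lie in Z[alpha > beta], so d_i = 0.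
    The h_i generate by the Jacobi-Trudi formula, so any unitriangular family does. *)

Set Implicit Arguments.
Unset Strict Implicit.
Unset Printing Implicit Defensive.

Import GRing.Theory.
Local Open Scope ring_scope.

(** * Alternants *)

(** Schur functions, coordinates, [G] and [g] are all given by [epsilon], so nothing is known about
    any of them before a witness exists: the Jacobi-Trudi determinant for [schur], a solution in
    each degree for the coordinates in the completion, a quotient of power series for [G], explicit
    sums for [g]. Since [G] is known only through a fraction, products with the Vandermonde
    determinant are computed modulo degrees above a bound [K], where 1 - a t has a polynomial
    inverse. The k - 1 in the binomials has two origins. For rows, (1 + a t)^(k - 1) times the
    one-variable G_(m) is t^m (1 + a t)^(k - 1 - m), of degree below k whenever m < k. For columns,
    k - 1 is the power of 1 - b t in the last column of the k-variable alternant; for a partition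
    with fewer than k parts that column is this power alone, so adjoining the same power as a
    further column makes the determinant vanish. *)

Section Alternants.

Variable R : idomainType.

Definition ev n (i : 'I_n) (q : {poly R}) : {mpoly R[n]} :=
  (map_poly (@mpolyC n R) q).['X_i].

Lemma evD n (i : 'I_n) : {morph ev i : p q / p + q}.
Proof. by move=> p q; rewrite /ev rmorphD hornerD. Qed.

Lemma evB n (i : 'I_n) : {morph ev i : p q / p - q}.
Proof. by move=> p q; rewrite /ev rmorphB /= hornerD hornerN. Qed.

Lemma evM n (i : 'I_n) : {morph ev i : p q / p * q}.
Proof. by move=> p q; rewrite /ev rmorphM hornerM. Qed.

Lemma evC n (i : 'I_n) c : ev i c%:P = c%:MP.
Proof. by rewrite /ev map_polyC hornerC. Qed.

Lemma ev1 n (i : 'I_n) : ev i 1 = 1.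
Proof. by rewrite -[1]polyC1 evC mpolyC1. Qed.

Lemma evX n (i : 'I_n) : ev i 'X = 'X_i.
Proof. by rewrite /ev map_polyX hornerX. Qed.

Lemma ev_exp n (i : 'I_n) p k : ev i (p ^+ k) = ev i p ^+ k.
Proof. by rewrite /ev rmorphXn /= horner_exp. Qed.

Lemma evZ n (i : 'I_n) c p : ev i (c *: p) = c *: ev i p.
Proof. by rewrite -mul_polyC evM evC mul_mpolyC. Qed.

Lemma evE n (i : 'I_n) (q : {poly R}) N : (size q <= N)%N ->
  ev i q = \sum_(k < N) q`_k *: 'X_i ^+ k.
Proof.
move=> le_qN; rewrite /ev (@horner_coef_wide _ N); last first.
  by rewrite (leq_trans (size_poly _ _)).
by apply: eq_bigr => k _; rewrite coef_map /= mul_mpolyC.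
Qed.

Lemma mcoeff_prod_ev n (p : 'I_n -> {poly R}) (m : 'X_{1..n}) :
  (\prod_i ev i (p i))@_m = \prod_i (p i)`_(m i).
Proof.
(* One [N] above all sizes and all exponents of [m] lets the product expand over functions into
   ['I_N], with [m] itself among them. *)
pose N := (\sum_i (size (p i) + m i)).+1.
have leN i : (size (p i) + m i < N)%N by rewrite ltnS (bigD1 i) //= leq_addr.
under eq_bigr => i _.
  rewrite (@evE _ _ _ N); last by rewrite ltnW // (leq_ltn_trans _ (leN i)) ?leq_addr.
  over.
rewrite bigA_distr_bigA /= raddf_sum /=.
under eq_bigr => f _.
  rewrite scaler_prod mcoeffZ.
  have -> : \prod_i ('X_i : {mpoly R[n]}) ^+ f i
          = 'X_[[multinom (f i : nat) | i < n]].
    by rewrite mpolyXE_id; apply: eq_bigr => i _; rewrite mnmE.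
  rewrite mcoeffX; over.
have ltm i : (m i < N)%N by rewrite (leq_ltn_trans _ (leN i)) ?leq_addl.
rewrite (bigD1 [ffun i => Ordinal (ltm i)]) //= [X in _ + X]big1 => [|f neq_f].
  rewrite addr0 (_ : [multinom _ | i < n] == m) ?mulr1; last first.
    by apply/eqP/mnmP => i; rewrite mnmE ffunE.
  by apply: eq_bigr => i _; rewrite ffunE.
case: eqP => [/mnmP eq_m|]; last by rewrite mulr0.
case/eqP: neq_f; apply/ffunP => i; apply/val_inj.
by rewrite ffunE /= -[RHS](eq_m i) mnmE.
Qed.

Definition alt n (p : 'I_n -> {poly R}) : {mpoly R[n]} :=
  \det (\matrix_(i < n, j < n) ev i (p j)).

(** Row i involves only x_i, so extracting x^m acts on each row separately. *)
Lemma mcoeff_alt n (p : 'I_n -> {poly R}) (m : 'X_{1..n}) :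
  (alt p)@_m = \det (\matrix_(i < n, j < n) (p j)`_(m i)).
Proof.
rewrite /alt /determinant raddf_sum /=; apply: eq_bigr => s _.
under eq_bigr => i _ do rewrite mxE.
have -> : (-1) ^+ s = ((-1) ^+ s)%:MP :> {mpoly R[n]}.
  by rewrite rmorphXn /= rmorphN1.
rewrite mcoeffCM mcoeff_prod_ev; congr (_ * _).
by apply: eq_bigr => i _; rewrite mxE.
Qed.

Lemma eq_alt n (p q : 'I_n -> {poly R}) : p =1 q -> alt p = alt q.
Proof.
by move=> eq_pq; congr (\det _); apply/matrixP => i j; rewrite !mxE eq_pq.
Qed.

Lemma alt_prodM n (p : 'I_n -> {poly R}) (u : {poly R}) :
  (\prod_i ev i u) * alt p = alt (fun j => u * p j).
Proof.
pose D : 'M_n := diag_mx (\row_i ev i u).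
have -> : \prod_i ev i u = \det D.
  by rewrite det_diag; apply: eq_bigr => i _; rewrite mxE.
rewrite /alt -det_mulmx; congr (\det _); apply/matrixP => i j.
by rewrite mul_diag_mx !mxE evM.
Qed.

Definition vdm n : {mpoly R[n]} :=
  \prod_(i < n) \prod_(j < n | (i < j)%N) ('X_i - 'X_j).

Lemma vdmE n : vdm n = alt (fun j : 'I_n => 'X^(n - j.+1)).
Proof.
(* Reversed variables turn the factors a_j - a_i of [det_Vandermonde] into x_i - x_j. Undoing this
   below applies the same permutation to rows and columns, so the signs cancel. *)
pose a : 'rV[{mpoly R[n]}]_n := \row_i 'X_(rev_ord i).
have -> : vdm n = \det (Vandermonde n a).
  rewrite det_Vandermonde /vdm.
  rewrite !pair_big_dep /=.
  rewrite (reindex (fun ij : 'I_n * 'I_n => (rev_ord ij.2, rev_ord ij.1))) /=; last first.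
    by exists (fun ij : 'I_n * 'I_n => (rev_ord ij.2, rev_ord ij.1)) => [] [i j] _ /=;
      rewrite !rev_ordK.
  apply: eq_big => [[i j] /=|[i j] _ /=]; last by rewrite !mxE.
  by have := ltn_ord i; have := ltn_ord j; lia.
rewrite /alt -det_tr; set A := _^T; set B := matrix_of_fun _ _.
have -> : B = row_perm (perm (@rev_ord_inj n)) (col_perm (perm (@rev_ord_inj n)) A).
  by apply/matrixP => i j; rewrite !mxE !permE ev_exp evX rev_ordK.
rewrite row_permE col_permE !det_mulmx !det_perm odd_permV mulrCA.
by rewrite -expr2 sqrr_sign mulr1.
Qed.

Lemma vdm_neq0 n : vdm n != 0.
Proof.
apply/prodf_neq0 => i _; apply/prodf_neq0 => j lt_ij; rewrite subr_eq0.
apply: contraTneq lt_ij => /(congr1 (mcoeff U_(i)))/eqP.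
rewrite !mcoeffXU eqxx; case: (j =P i) => [->|_]; first by rewrite ltnn.
by rewrite oner_eq0.
Qed.

End Alternants.

(** * Partitions and the strictly decreasing exponents of lambda + delta *)

Lemma nth_part_gt0 (lam : intpart) i : (0 < nth 0%N lam i)%N = (i < size lam)%N.
Proof.
case: (ltnP i (size lam)) => [lt_i|le_i]; last by rewrite nth_default.
case: lam lt_i => s /= /andP[_ s0] lt_i; rewrite lt0n.
by apply: contraNneq s0 => <-; apply: mem_nth.
Qed.

Lemma nth_part_mono (lam : intpart) i j : (i <= j)%N ->
  (nth 0 lam j <= nth 0 lam i)%N.
Proof.
move=> le_ij; case: (ltnP j (size lam)) => [lt_j|le_j]; last by rewrite nth_default.
case: lam lt_j => s /= /andP[sorted_s _] lt_j.
have geq_trans : transitive geq by move=> a b c /= ab bc; apply: leq_trans bc ab.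
have := sorted_leq_nth geq_trans (leqnn) 0%N sorted_s.
by move=> /(_ i j); rewrite !inE; apply => //; apply: leq_ltn_trans lt_j.
Qed.

Lemma intpart_eq (lam mu : intpart) :
  (forall i, nth 0%N lam i = nth 0%N mu i) -> lam = mu.
Proof.
move=> eq_lm; apply: val_inj => /=; apply: (@eq_from_nth _ 0%N) => [|i _]; last exact: eq_lm.
apply/eqP; rewrite eqn_leq; apply/andP; split; rewrite leqNgt -nth_part_gt0.
  by rewrite eq_lm nth_part_gt0 ltnn.
by rewrite -eq_lm nth_part_gt0 ltnn.
Qed.

(* The exponents of lambda + delta, where delta = (n - 1, ..., 1, 0). *)
Definition ed n (s : seq nat) (j : 'I_n) := (nth 0 s j + (n - j.+1))%N.

Definition edm n (s : seq nat) : 'X_{1..n} := [multinom ed s i | i < n].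

Lemma ed_decr n (lam : intpart) (i j : 'I_n) : (i < j)%N ->
  (ed lam j < ed lam i)%N.
Proof.
move=> lt_ij; have := @nth_part_mono lam i j (ltnW lt_ij).
by have := ltn_ord j; rewrite /ed; lia.
Qed.

Lemma ed_noninc n (lam : intpart) (i j : 'I_n) : (i <= j)%N ->
  (ed lam j <= ed lam i)%N.
Proof.
rewrite leq_eqVlt => /orP[/eqP/val_inj-> //|/ed_decr lt]; exact: ltnW.
Qed.

(** Otherwise s would inject the indices at least i into those above i, of which there is one fewer.
    Along decreasing sequences this turns inequalities up to a permutation into inequalities at each
    index. *)
Lemma perm_crossing n (s : 'S_n) (i : 'I_n) :
  exists2 i' : 'I_n, (i <= i')%N & (s i' <= i)%N.
Proof.
case: (pickP [pred i' : 'I_n | (i <= i') && (s i' <= i)]%N) => [i' /andP[]|no_i'].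
  by exists i'.
pose A := [set k : 'I_n | (i <= k)%N]; pose B := [set k : 'I_n | (i < k)%N].
have : (#|s @: A| <= #|B|)%N.
  apply/subset_leq_card/subsetP => x /imsetP[k]; rewrite inE => le_ik ->.
  by have := no_i' k; rewrite /= le_ik inE ltnNge /= => ->.
rewrite card_imset; last exact: perm_inj.
have -> : A = i |: B.
  by apply/setP => k; rewrite !inE leq_eqVlt eq_sym.
by rewrite cardsU1 inE ltnn ltnn.
Qed.

(** * Coefficients of alternants at lambda + delta *)

Section Triangularity.

Variable R : idomainType.

Lemma det_neq0_perm n (A : 'M[R]_n) : \det A != 0 ->
  exists s : 'S_n, forall i, A i (s i) != 0.
Proof.
case: (pickP (fun s : 'S_n => [forall i, A i (s i) != 0])) => [s /forallP|no_s nzA].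
  by exists s.
case/eqP: nzA; apply: big1 => s _; have /negbT/forallPn[i] := no_s s.
by rewrite negbK => /eqP A0; rewrite (bigD1 i) //= A0 mul0r mulr0.
Qed.

Lemma coef_shift_neq0 e f (r : {poly R}) : ('X^e * r)`_f != 0 -> (e <= f)%N.
Proof. by rewrite coefXnM; case: ltnP => //; rewrite eqxx. Qed.

(** A nonzero determinant has a nonzero term, hence a permutation s with mu + delta at s i at most
    lambda + delta at i. A crossing index i' and monotonicity remove the permutation. *)
Lemma alt_coef_contained n (lam mu : intpart) (r : 'I_n -> {poly R}) :
  (alt (fun j => 'X^(ed mu j) * r j))@_(edm n lam) != 0 ->
  forall i : 'I_n, (nth 0 mu i <= nth 0 lam i)%N.
Proof.
rewrite mcoeff_alt => /det_neq0_perm[s nz_s] i.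
have [i' le_ii' le_si'] := perm_crossing s i.
have := nz_s i'; rewrite mxE mnmE => /coef_shift_neq0.
have := @ed_noninc n lam i i' le_ii'; have := @ed_noninc n mu (s i') i le_si'.
by move=> le1 le2 le3; have := leq_trans (leq_trans le1 le3) le2; rewrite leq_add2r.
Qed.

(** The exponents strictly decrease, so the matrix is triangular, with the constant terms of the
    [r j] on its diagonal. *)
Lemma alt_coef_diag n (lam : intpart) (r : 'I_n -> {poly R}) :
  (forall j, (r j)`_0 = 1) ->
  (alt (fun j => 'X^(ed lam j) * r j))@_(edm n lam) = 1.
Proof.
move=> r0; rewrite mcoeff_alt -det_tr det_trig.
  by rewrite big1 // => i _; rewrite !mxE mnmE coefXnM ltnn subnn.
apply/is_trig_mxP => i j lt_ij; rewrite !mxE mnmE.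
by apply: contraTeq (ed_decr lam lt_ij) => /coef_shift_neq0; rewrite -leqNgt.
Qed.

Lemma alt_coef_monomial n (lam mu : intpart) :
  (size lam <= n)%N -> (size mu <= n)%N ->
  (alt (fun j : 'I_n => 'X^(ed mu j) : {poly R}))@_(edm n lam) = (mu == lam)%:R.
Proof.
move=> szl szm; have [<-|neq_ml] := eqVneq.
  rewrite -[RHS](@alt_coef_diag n mu (fun=> 1)) => [|j]; last by rewrite coef1.
  by congr (_@__); apply: eq_alt => j; rewrite mulr1.
apply: contraNeq neq_ml => nz_a.
have [s nz_s] : exists s : 'S_n, forall i, ed lam i = ed mu (s i).
  move: nz_a; rewrite mcoeff_alt => /det_neq0_perm[s nz_s]; exists s => i.
  have := nz_s i; rewrite mxE mnmE coefXn.
  by case: (ed lam i =P ed mu (s i)) => // _; rewrite eqxx.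
(* The crossing argument for s gives one inequality, for its inverse the other. *)
have eq_n i : (i < n)%N -> nth 0%N mu i = nth 0%N lam i.
  move=> lt_in; pose i0 := Ordinal lt_in; apply/eqP; rewrite eqn_leq; apply/andP; split.
    have [i' /(ed_noninc lam) le1 /(ed_noninc mu) le2] := perm_crossing s i0.
    by have := leq_trans le2 (leq_trans (eq_leq (esym (nz_s i'))) le1); rewrite leq_add2r.
  have [i' /(ed_noninc mu) le1 /(ed_noninc lam)] := perm_crossing (s^-1)%g i0.
  rewrite [ed lam ((s^-1)%g i')]nz_s permKV => le2.
  by have := leq_trans le2 le1; rewrite leq_add2r.
apply/eqP/intpart_eq => i; case: (ltnP i n) => [/eq_n //|le_ni].
by rewrite !nth_default // (leq_trans _ le_ni).
Qed.

End Triangularity.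

(** * Complete symmetric functions and the Jacobi-Trudi formula *)

HB.instance Definition _ (R : idomainType) n := GRing.RMorphism.copy (@restr R n)
  (comp_mpoly [tuple oapp (fun j : 'I_n => 'X_j) 0 (unlift ord_max i) | i < n.+1]).

Lemma bigprod_dhomog (R : idomainType) n I (r : seq I)
    (F : I -> {mpoly R[n]}) (d : I -> nat) :
  (forall i, F i \is (d i).-homog) ->
  \prod_(i <- r) F i \is (\sum_(i <- r) d i)%N.-homog.
Proof.
move=> homF; elim: r => [|i r IHr]; first by rewrite !big_nil dhomog1.
by rewrite !big_cons dhomogM.
Qed.

Section CompleteSymmetric.

Variable R : idomainType.

Lemma restr_widen n (i : 'I_n) :
  restr ('X_(widen_ord (leqnSn n) i) : {mpoly R[n.+1]}) = 'X_i.
Proof.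
rewrite /restr comp_mpolyXU -tnth_nth tnth_mktuple.
have -> : widen_ord (leqnSn n) i = lift ord_max i.
  by apply: val_inj; rewrite /= /bump leqNgt ltn_ord.
by rewrite liftK.
Qed.

Lemma restr_max n : restr ('X_ord_max : {mpoly R[n.+1]}) = 0.
Proof.
by rewrite /restr comp_mpolyXU -tnth_nth tnth_mktuple unlift_none.
Qed.

Lemma restrZ n c (p : {mpoly R[n.+1]}) : restr (c *: p) = c *: restr p.
Proof. exact: comp_mpolyZ. Qed.

Lemma mcoeff_restr n (p : {mpoly R[n.+1]}) (m : 'X_{1..n}) :
  (restr p)@_m = p@_(mnmwiden m).
Proof.
rewrite [p in LHS]mpolyE [p in RHS]mpolyE (raddf_sum (@restr R n)) !(raddf_sum (mcoeff _)) /=.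
apply: eq_bigr => k _.
rewrite restrZ !mcoeffZ mcoeffX; congr (_ * _).
rewrite mpolyXE_id big_ord_recr rmorphM rmorphXn /= restr_max rmorph_prod /=.
under eq_bigr do rewrite rmorphXn /= restr_widen.
have -> : \prod_(i < n) ('X_i : {mpoly R[n]}) ^+ k (widen_ord (leqnSn n) i)
        = 'X_[[multinom k (widen_ord (leqnSn n) i) | i < n]].
  by rewrite mpolyXE_id; apply: eq_bigr => i _; rewrite mnmE.
have [k0|k0] := eqVneq (k ord_max) 0%N; last first.
  rewrite expr0n (negPf k0) mulr0 mcoeff0.
  case: eqP => // eq_k; move: k0; rewrite eq_k.
  by rewrite mnmwiden_ordmax.
rewrite k0 expr0 mulr1 mcoeffX; congr (_%:R); congr nat_of_bool.
apply/eqP/eqP => [<-|->].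
  apply/mnmP => i; case: (unliftP ord_max i) => [j ->|->]; last by rewrite mnmwiden_ordmax.
  have -> : lift ord_max j = widen_ord (leqnSn n) j.
    by apply: val_inj; rewrite /= /bump leqNgt ltn_ord.
  by rewrite mnmwiden_widen mnmE.
by apply/mnmP => i; rewrite mnmE mnmwiden_widen.
Qed.

Definition sfev n (f : symfun R) : {mpoly R[n]} := f n.

Fact sfev_additive n : additive (@sfev n).
Proof. by []. Qed.
HB.instance Definition _ n :=
  GRing.isAdditive.Build (symfun R) {mpoly R[n]} (@sfev n) (@sfev_additive n).

Fact sfev_multiplicative n : multiplicative (@sfev n).
Proof. by []. Qed.
HB.instance Definition _ n :=
  GRing.isMultiplicative.Build (symfun R) {mpoly R[n]} (@sfev n)
    (@sfev_multiplicative n).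

(** As a power series in t its inverse generates the complete symmetric functions. *)
Definition Epoly n : {poly {mpoly R[n]}} := \prod_(i < n) (1 - 'X_i *: 'X).

Lemma Epoly_dhomog n j : (Epoly n)`_j \is j.-homog.
Proof.
rewrite /Epoly; elim/big_rec: _ j => [|i p _ IHp] j.
  by rewrite coef1; case: j => [|j]; rewrite ?dhomog1 ?dhomog0.
rewrite mulrBl mul1r -scalerAl coefB coefZ coefXM rpredB //.
case: j => [|j] /=; first by rewrite mulr0 dhomog0.
by rewrite -add1n; apply: dhomogM => //; rewrite dhomogX /= mdeg1.
Qed.

Fact csf_sym j n : (Epoly n)`_j \is symmetric.
Proof.
apply/issymP => s; rewrite -[RHS]/((Epoly n)`_j) -[msym s _](@coef_map _ _ (@msym n R s)).
congr ((polyseq _)`_j); rewrite /Epoly rmorph_prod /=.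
rewrite [RHS](reindex_inj (@perm_inj _ s)) /=; apply: eq_bigr => i _.
rewrite rmorphB rmorph1 /= map_polyZ /= map_polyX; congr (1 - _ *: _).
rewrite msymX; congr 'X_[_]; apply/mnmP => k; rewrite mnmE !mnm1E.
by rewrite -(inj_eq (@perm_inj _ s)) permKV.
Qed.

Fact csf_stable j n : restr (Epoly n.+1)`_j = (Epoly n)`_j.
Proof.
rewrite -(@coef_map _ _ (@restr R n)); congr ((polyseq _)`_j).
rewrite /Epoly rmorph_prod big_ord_recr /= rmorphB rmorph1 /= map_polyZ /=.
rewrite restr_max scale0r subr0 mulr1; apply: eq_bigr => i _.
by rewrite rmorphB rmorph1 /= map_polyZ /= map_polyX restr_widen.
Qed.

Fact csf_bounded j : exists d, forall n, (msize (Epoly n)`_j <= d)%N.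
Proof.
exists j.+1 => n; rewrite msizeE; apply/bigmax_leqP_seq => m m_supp _.
by rewrite (dhomog_mf (Epoly_dhomog n j)).
Qed.

(* (-1)^j times the elementary symmetric function e_j. *)
Definition csf j : symfun R := SymFun (@csf_sym j) (@csf_stable j) (csf_bounded j).

(** The list h_0, ..., h_k, from the relation E(t) H(t) = 1 read inside [symfun], so that symmetry
    and stability come for free. The whole list is carried because the recurrence uses all earlier
    values. *)
Fixpoint hsf_seq k : seq (symfun R) :=
  if k is k'.+1 then
    let s := hsf_seq k' in
    rcons s (- \sum_(j < k) csf j.+1 * nth 0 s (k' - j))
  else [:: 1].

Definition hsf k := nth 0 (hsf_seq k) k.

Lemma size_hsf_seq k : size (hsf_seq k) = k.+1.
Proof. by elim: k => //= k IHk; rewrite size_rcons IHk. Qed.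

Lemma nth_hsf_seq k i : (i <= k)%N -> nth 0 (hsf_seq k) i = hsf i.
Proof.
elim: k => [|k IHk]; first by rewrite leqn0 => /eqP->.
rewrite leq_eqVlt => /orP[/eqP-> //|lt_ik].
by rewrite /= nth_rcons size_hsf_seq lt_ik IHk.
Qed.

Lemma csf0 : csf 0 = 1.
Proof.
apply: symfunP => n /=; rewrite /Epoly coef0_prod big1 // => i _.
by rewrite coefB coef1 coefZ coefX mulr0 subr0.
Qed.

Lemma hsf0 : hsf 0 = 1. Proof. by []. Qed.

Lemma hsf_rec k : hsf k.+1 = - \sum_(j < k.+1) csf j.+1 * hsf (k - j).
Proof.
rewrite {1}/hsf /= nth_rcons size_hsf_seq ltnn eqxx; congr (- _).
by apply: eq_bigr => j _; rewrite nth_hsf_seq // leq_subr.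
Qed.

Lemma csf_hsf_conv k : \sum_(j < k.+1) csf j * hsf (k - j) = (k == 0%N)%:R.
Proof.
case: k => [|k]; first by rewrite big_ord1 csf0 mul1r.
rewrite big_ord_recl csf0 mul1r subn0 hsf_rec /=.
by apply/eqP; rewrite addrC subr_eq0; apply/eqP/eq_bigr.
Qed.

Lemma hsf_dhomog k n : hsf k n \is k.-homog.
Proof.
elim/ltn_ind: k => -[|k] IHk; first exact: dhomog1.
rewrite hsf_rec -/(sfev n _) rmorphN rpredN rmorph_sum rpred_sum // => j _.
have le_jk : (j <= k)%N by rewrite -ltnS.
have lt_kj : (k - j < k.+1)%N by rewrite ltnS leq_subr.
by have := dhomogM (Epoly_dhomog n j.+1) (IHk _ lt_kj); rewrite addSn subnKC.
Qed.

(** The test is needed because truncated subtraction would give h_0 = 1 for a negative index. *)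
Definition hsub a b := if (b <= a)%N then hsf (a - b) else 0.

Definition Dpoly n (i : 'I_n) : {poly {mpoly R[n]}} :=
  \prod_(l < n | l != i) (1 - 'X_l *: 'X).

Lemma size_Dpoly n (i : 'I_n) : (size (Dpoly i) <= n)%N.
Proof.
apply: leq_trans (size_prod_leq _ _) _.
pose F (l : 'I_n) : {poly {mpoly R[n]}} := 1 - 'X_l *: 'X.
have sz2 l : (size (F l) <= 2)%N.
  apply: leq_trans (size_polyD _ _) _; rewrite size_poly1 size_polyN geq_max /=.
  by apply: leq_trans (size_scale_leq _ _) _; rewrite size_polyX.
have le2 : (\sum_(l < n | l != i) size (F l) <= \sum_(l < n | l != i) 2)%N.
  by apply: leq_sum.
rewrite sum_nat_const in le2.
have := cardC1 i; rewrite card_ord => cardn.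
have eq_card : #|[pred l : 'I_n | l != i]| = n.-1 by rewrite -cardn; apply: eq_card.
rewrite eq_card in le2 *.
apply: (@leq_trans ((n.-1 * 2).+1 - n.-1)); last by have := ltn_ord i; lia.
by apply: leq_sub2r; rewrite ltnS.
Qed.

(** [Dpoly i] is E(t) / (1 - x_i t), so its product with H(t) is 1 / (1 - x_i t); this reads off the
    coefficient of t^k. The range s < n is independent of k: terms with s > k vanish through [hsub],
    those with s >= n by degree. *)
Lemma exp_hsub n (i : 'I_n) k :
  'X_i ^+ k = \sum_(s < n) (Dpoly i)`_s * sfev n (hsub k s).
Proof.
pose H N : {poly {mpoly R[n]}} := \poly_(j < N) sfev n (hsf j).
have DH N : (k < N)%N -> (Dpoly i * H N)`_k = 'X_i ^+ k.
  have EH j : (j < N)%N -> (Epoly n * H N)`_j = (j == 0%N)%:R.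
    move=> lt_jN; rewrite -(rmorph_nat (@sfev n)) -csf_hsf_conv rmorph_sum coefM.
    apply: eq_bigr => l _; rewrite coef_poly rmorphM /=.
    by rewrite (leq_ltn_trans (leq_subr _ _)).
  have ED : Epoly n = (1 - 'X_i *: 'X) * Dpoly i by rewrite /Epoly (bigD1 i).
  elim: k => [|k IHk] lt_kN.
    have := EH _ lt_kN; rewrite ED -mulrA mulrBl mul1r -scalerAl coefB coefZ coefXM.
    by rewrite mulr0 subr0.
  have := EH _ lt_kN; rewrite ED -mulrA mulrBl mul1r -scalerAl coefB coefZ coefXM /=.
  by move/eqP; rewrite subr_eq0 IHk ?(ltnW lt_kN) // -exprS => /eqP.
rewrite -(DH k.+1) // coefM.
have termE (s : nat) : (s < k.+1)%N ->
    (Dpoly i)`_s * (H k.+1)`_(k - s) = (Dpoly i)`_s * sfev n (hsub k s).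
  rewrite ltnS => le_sk; rewrite coef_poly /hsub le_sk.
  by rewrite ltnS leq_subr.
under eq_bigr => s _ do rewrite (termE s (ltn_ord s)).
rewrite -(big_mkord xpredT (fun s => (Dpoly i)`_s * sfev n (hsub k s))).
rewrite -(big_mkord xpredT (fun s => (Dpoly i)`_s * sfev n (hsub k s))).
have cut a b : (a <= b)%N ->
    (forall s, (a <= s)%N -> (Dpoly i)`_s * sfev n (hsub k s) = 0) ->
    \sum_(0 <= s < a) (Dpoly i)`_s * sfev n (hsub k s) =
    \sum_(0 <= s < b) (Dpoly i)`_s * sfev n (hsub k s).
  move=> le_ab z0; rewrite [RHS](@big_cat_nat _ _ _ a) //=.
  rewrite [X in _ + X]big_nat_cond [X in _ + X]big1 ?addr0 //.
  by move=> s /andP[/andP[/z0]].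
rewrite (@cut k.+1 (maxn k.+1 n)) ?leq_maxl // => [|s lt_ks]; last first.
  by rewrite /hsub leqNgt lt_ks rmorph0 mulr0.
rewrite -(@cut n (maxn k.+1 n)) ?leq_maxr // => s le_ns.
by rewrite nth_default ?mul0r // (leq_trans (size_Dpoly i)).
Qed.

Definition hpoly (q : {poly R}) b : symfun R := \sum_(k < size q) q`_k *: hsub k b.

Lemma hpolyXn k b : hpoly 'X^k b = hsub k b.
Proof.
rewrite /hpoly size_polyXn big_ord_recr /= coefXn eqxx scale1r big1 ?add0r // => i _.
by rewrite coefXn ltn_eqF ?scale0r.
Qed.

Lemma ev_hpoly n (i : 'I_n) q :
  ev i q = \sum_(s < n) (Dpoly i)`_s * sfev n (hpoly q s).
Proof.
rewrite (@evE _ _ _ _ (size q)) //.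
under eq_bigr do rewrite exp_hsub scaler_sumr.
rewrite exchange_big; apply: eq_bigr => s _ /=.
rewrite rmorph_sum mulr_sumr; apply: eq_bigr => k _.
by rewrite scalerAr.
Qed.

(* The factor det D of alt q = det D * det H does not depend on q, and det H = 1
   when q gives the Vandermonde determinant; so det D is the latter. *)
Lemma alt_vdm n (q : 'I_n -> {poly R}) :
  alt q = vdm R n *
    sfev n (\det (\matrix_(s < n, j < n) hpoly (q j) (n - s.+1))).
Proof.
pose D : 'M_n := \matrix_(i < n, s < n) (Dpoly i)`_(n - s.+1).
have altE p : alt p = \det D *
    sfev n (\det (\matrix_(s < n, j < n) hpoly (p j) (n - s.+1))).
  rewrite -det_map_mx -det_mulmx; congr (\det _); apply/matrixP => i j.
  rewrite !mxE ev_hpoly (reindex_inj rev_ord_inj) /=.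
  by apply: eq_bigr => s _; rewrite !mxE.
suff -> : vdm R n = \det D by apply: altE.
rewrite vdmE altE [X in _ * sfev _ X]det_trig; last first.
  apply/is_trig_mxP => s j lt_sj; rewrite mxE /= hpolyXn /hsub.
  by have := ltn_ord j; case: ifP => //; lia.
rewrite big1 ?rmorph1 ?mulr1 // => s _.
by rewrite mxE /= hpolyXn /hsub leqnn subnn.
Qed.

Definition JT (lam : seq nat) n : symfun R :=
  \det (\matrix_(s < n, j < n) hsub (nth 0%N lam j + s) j).

(** The last column belongs to a zero part, so it vanishes except for its bottom entry h_0 = 1. *)
Lemma JT_stable lam n : (size lam <= n)%N -> JT lam n.+1 = JT lam n.
Proof.
move=> szl; rewrite /JT (expand_det_col _ ord_max) big_ord_recr /= big1 ?add0r.
  rewrite mxE /hsub nth_default // add0n leqnn subnn hsf0 mul1r.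
  rewrite /cofactor -signr_odd oddD addbb mul1r; congr (\det _).
  by apply/matrixP => i j; rewrite !mxE !lift_max.
move=> i _; rewrite mxE /hsub nth_default // add0n /= leqNgt ltn_ord.
by rewrite mul0r.
Qed.

Lemma JT_eq lam n : (size lam <= n)%N -> JT lam n = JT lam (size lam).
Proof.
move=> /subnKC<-; elim: (n - _)%N => [|k IHk]; first by rewrite addn0.
by rewrite addnS JT_stable ?leq_addr.
Qed.

Lemma vdm_JT n (lam : seq nat) : (size lam <= n)%N ->
  vdm R n * JT lam (size lam) n = alt (fun j : 'I_n => 'X^(ed lam j)).
Proof.
move=> szl; rewrite alt_vdm -(JT_eq szl) -/(sfev n _); congr (_ * sfev n (\det _)).
apply/matrixP => s j; rewrite !mxE /= hpolyXn /hsub /ed.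
have := ltn_ord s; have := ltn_ord j => ltj lts.
have -> : (nth 0 lam j + (n - j.+1) - (n - s.+1) = nth 0 lam j + s - j)%N by lia.
have -> : (n - s.+1 <= nth 0 lam j + (n - j.+1))%N = (j <= nth 0 lam j + s)%N by lia.
by [].
Qed.

Lemma JT_is_schur (lam : intpart) : is_schur lam (JT lam (size lam)).
Proof.
move=> n _ szl; set P := \prod_i _.
have -> : P = tofrac (vdm R n).
  rewrite rmorph_prod; apply: eq_bigr => i _.
  by rewrite rmorph_prod.
have -> : \det (\matrix_(i < n, j < n)
    tofrac ('X_i ^+ (nth 0%N lam j + (n - j.+1)) : {mpoly R[n]})) =
    tofrac (alt (fun j : 'I_n => 'X^(ed lam j) : {poly R})).
  rewrite -det_map_mx; congr (\det _); apply/matrixP => i j.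
  by rewrite !mxE ev_exp evX.
by rewrite -vdm_JT // rmorphM mulrC mulKf // tofrac_eq0 vdm_neq0.
Qed.

(** Setting a variable to 0 carries equality from n + 1 to n variables; hence a formula valid only
    in many variables, such as [is_schur], determines the function. *)
Lemma symfun_eq_ge (f g : symfun R) N :
  (forall n, (N <= n)%N -> f n = g n) -> f = g.
Proof.
move=> eq_fg; apply: symfunP => n.
suff: forall k, f (n + (N - k))%N = g (n + (N - k))%N.
  by move=> /(_ N); rewrite subnn addn0.
elim=> [|k IHk]; first by rewrite subn0; apply: eq_fg; rewrite leq_addl.
case: (ltnP k N) => [lt_kN|le_Nk]; last first.
  by move: IHk; rewrite (eqP le_Nk) (eqP (leqW le_Nk)).
rewrite -(subnSK lt_kN) addnS in IHk.
by rewrite -(sf_stable f) -(sf_stable g) IHk.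
Qed.

Lemma schurE (lam : intpart) : schur R lam = JT lam (size lam).
Proof.
have := epsilon_spec (inhabits 0) (is_schur lam) (ex_intro _ _ (@JT_is_schur lam)).
rewrite -/(schur R lam) => schurP.
apply: (@symfun_eq_ge _ _ (size lam).+1) => n lt_n.
have n_gt0 : (0 < n)%N by apply: leq_ltn_trans lt_n.
apply/eqP; rewrite -tofrac_eq; apply/eqP.
by rewrite schurP ?(ltnW lt_n) // JT_is_schur // ltnW.
Qed.

Lemma vdm_schur n (lam : intpart) : (size lam <= n)%N ->
  vdm R n * schur R lam n = alt (fun j : 'I_n => 'X^(ed lam j)).
Proof. by move=> szl; rewrite schurE vdm_JT. Qed.

Lemma schur_row k : schur R (rowp k) = hsf k.
Proof.
rewrite schurE; case: k => [|k] /=; first by rewrite /JT det_mx00.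
by rewrite /JT det_mx11 mxE /hsub /= addn0 subn0.
Qed.

(** In a term of the determinant the degrees lambda_(s i) + i - s i add up to the size of lambda,
    since the shifts cancel. Terms containing a zero entry are treated apart. *)
Lemma schur_dhomog (lam : intpart) n : schur R lam n \is (sumn lam).-homog.
Proof.
rewrite schurE -/(sfev n _) /JT /determinant rmorph_sum rpred_sum // => s _.
rewrite rmorphM rmorph_sign rpredMsign rmorph_prod.
have [/forallP le_s|/forallPn[j lt_j]] :=
  boolP [forall j, (s j <= nth 0 lam (s j) + j)%N]; last first.
  by rewrite (bigD1 j) //= mxE /hsub (negPf lt_j) rmorph0 mul0r dhomog0.
have -> : sumn lam = (\sum_(i < size lam) (nth 0 lam (s i) + i - s i))%N.
  apply/eqP; rewrite -(eqn_add2r (\sum_(i < size lam) s i)%N) -big_split /=.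
  under [X in _ == X]eq_bigr => i _ do rewrite subnK //.
  have sum_perm (F : 'I_(size lam) -> nat) : (\sum_i F (s i) = \sum_i F i)%N.
    by rewrite [RHS](reindex_inj (@perm_inj _ s)).
  rewrite big_split /= (sum_perm (fun i => i : nat)) (sum_perm (fun i => nth 0%N lam i)).
  by rewrite eqn_add2r sumnE (big_nth 0%N) big_mkord.
by apply: bigprod_dhomog => i; rewrite mxE /hsub le_s hsf_dhomog.
Qed.

End CompleteSymmetric.

(** * Truncated power series *)

Section Truncation.

Variables (R : idomainType) (n : nat).
Implicit Types (P Q d : {mpoly R[n]}) (m : 'X_{1..n}) (F : mseries R n).

Definition eqtrunc K P Q := forall m, (mdeg m <= K)%N -> P@_m = Q@_m.

Lemma eqtruncM K P P' Q Q' :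
  eqtrunc K P P' -> eqtrunc K Q Q' -> eqtrunc K (P * Q) (P' * Q').
Proof.
move=> eqP eqQ m le_mK; rewrite !mcoeffM; apply: eq_bigr => -[k1 k2] _ /=.
have := bmdeg k1; have := bmdeg k2; rewrite !ltnS => le2 le1.
by rewrite eqP ?eqQ // (leq_trans _ le_mK).
Qed.

Lemma eqtruncMl K P Q Q' : eqtrunc K Q Q' -> eqtrunc K (P * Q) (P * Q').
Proof. exact: eqtruncM. Qed.

Lemma eqtrunc_trans K Q P S : eqtrunc K P Q -> eqtrunc K Q S -> eqtrunc K P S.
Proof. by move=> PQ QS m le_mK; rewrite PQ ?QS. Qed.

(** Induction on the degree: the coefficient of d * E at m is that of E plus multiples of
    coefficients of E of lower degree. *)
Lemma eqtrunc_cancel K d P Q : d@_0%MM = 1 ->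
  eqtrunc K (d * P) (d * Q) -> eqtrunc K P Q.
Proof.
move=> d0 eq_d; suff: eqtrunc K (P - Q) 0.
  by move=> eq0 m /eq0/eqP; rewrite mcoeffB mcoeff0 subr_eq0 => /eqP.
have {}eq_d m : (mdeg m <= K)%N -> (d * (P - Q))@_m = 0.
  by move=> /eq_d eq_m; rewrite mulrBr mcoeffB eq_m subrr.
move: (P - Q) eq_d => E eq_d m; have [k le_mk] := ubnP (mdeg m).
elim: k m le_mk => // k IHk m; rewrite ltnS => le_mk le_mK.
have := eq_d m le_mK; rewrite mcoeffM mcoeff0.
have lt0 : (mdeg (0%MM : 'X_{1..n}) < (mdeg m).+1)%N by rewrite mdeg0.
rewrite (bigD1 (BMultinom lt0, BMultinom (ltnSn (mdeg m)))) /=; last by rewrite add0m.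
rewrite d0 mul1r big1 ?addr0 // => -[k1 k2] /= /andP[/eqP eq_m neq_k].
have k1_neq0 : bmnm k1 != 0%MM.
  apply: contra neq_k => /eqP k10; apply/eqP; congr (_, _); apply: val_inj => //=.
  by rewrite [RHS]eq_m k10 add0m.
have deg_m : mdeg m = (mdeg k1 + mdeg k2)%N by rewrite -mdegD -eq_m.
rewrite IHk ?mcoeff0 ?mulr0 //; last by lia.
by move: k1_neq0; rewrite -mdeg_eq0; lia.
Qed.

Definition trunc K F : {mpoly R[n]} := \sum_(m : 'X_{1..n < K.+1}) F m *: 'X_[m].

Lemma mcoeff_trunc K F m : (mdeg m <= K)%N -> (trunc K F)@_m = F m.
Proof. by move=> le_mK; rewrite /trunc mcoeff_mpoly. Qed.

(* The product of a polynomial and a power series, as in expansion. *)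
Definition smul d F m := \sum_(k <- msupp d | (k <= m)%MM) d@_k * F (m - k)%MM.

Lemma mcoeffMX_le P k m : (P * 'X_[k])@_m = if (k <= m)%MM then P@_(m - k)%MM else 0.
Proof.
case: ifP => [le_km|/negP nle_km]; first by rewrite -{1}(submK le_km) addmC mcoeffMX.
apply: memN_msupp_eq0; rewrite (perm_mem (msuppMX P k)).
by apply/negP => /mapP[m' _ eq_m]; apply: nle_km; rewrite eq_m lem_addr.
Qed.

(** The coefficient at m sees F only up to degree deg m, so a polynomial truncation can replace the
    series. *)
Lemma smulE d F P m : (forall m', (mdeg m' <= mdeg m)%N -> F m' = P@_m') ->
  smul d F m = (d * P)@_m.
Proof.
move=> eqFP; rewrite {2}[d]mpolyE mulr_suml raddf_sum /= /smul big_mkcond /=.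
apply: eq_bigr => k _; rewrite -scalerAl mcoeffZ mulrC [_ * P]mulrC mcoeffMX_le.
case: ifP => _; last by rewrite mulr0.
by rewrite mulrC eqFP // mdegB.
Qed.

End Truncation.

(** * Schur expansions *)

Definition mon n (s : seq nat) : 'X_{1..n} := [multinom nth 0%N s i | i < n].

Lemma mnmwiden_mon n s : (size s <= n)%N -> mnmwiden (mon n s) = mon n.+1 s.
Proof.
move=> szs; apply/mnmP => i; rewrite mnmE.
case: (unliftP ord_max i) => [j ->|->].
  have -> : lift ord_max j = widen_ord (leqnSn n) j.
    by apply: val_inj; rewrite [LHS]lift_max.
  by rewrite mnmwiden_widen mnmE.
by rewrite mnmwiden_ordmax nth_default.
Qed.

Lemma mpart_is_part n (m : 'X_{1..n}) : is_part (sort geq [seq k <- m | k != 0%N]).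
Proof.
rewrite /is_part mem_sort mem_filter eqxx andbT.
by apply: sort_sorted => a b; apply: leq_total.
Qed.

Definition mpart n (m : 'X_{1..n}) : intpart := IntPart (mpart_is_part m).

Lemma val_mon n s : (size s <= n)%N -> val (mon n s) = s ++ nseq (n - size s) 0%N :> seq nat.
Proof.
move=> szs; apply: (@eq_from_nth _ 0%N) => [|i lt_i].
  by rewrite size_tuple size_cat size_nseq subnKC.
rewrite size_tuple in lt_i.
rewrite -[nth _ (val _) i]/(nth 0%N (mon n s) (Ordinal lt_i)) -mnm_nth mnmE /=.
rewrite nth_cat; case: ltnP => // le_i.
by rewrite nth_default // nth_nseq if_same.
Qed.

Lemma perm_mpart n (m : 'X_{1..n}) : perm_eq m (mon n (mpart m)).
Proof.
have sz_part : size (mpart m) = count (predC1 0%N) m.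
  by rewrite /= size_sort size_filter.
have szm : size m = n by rewrite size_tuple.
have -> : mon n (mpart m) = mpart m ++ nseq (n - size (mpart m)) 0%N :> seq nat.
  by apply: val_mon; rewrite sz_part -[leqRHS]szm count_size.
have -> : (n - size (mpart m))%N = count (pred1 0%N) m.
  have := count_predC (predC1 0%N) m; rewrite szm sz_part => {1}<-; rewrite addKn.
  by apply: eq_count => k; rewrite /= negbK.
rewrite -(perm_filterC (predC1 0%N) m); apply: perm_cat.
  by rewrite /= perm_sym perm_sort.
have -> : [seq x <- m | predC (predC1 0%N) x] = nseq (count (pred1 0%N) m) 0%N.
  rewrite -size_filter; set t := filter _ m.
  have -> : [seq x <- m | pred1 0%N x] = t by apply: eq_filter => k; rewrite /= negbK.
  by apply/all_pred1P/allP => k; rewrite mem_filter /= negbK => /andP[].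
exact: perm_refl.
Qed.

Lemma size_mpart n (m : 'X_{1..n}) : (size (mpart m) <= n)%N.
Proof.
by rewrite /= size_sort size_filter (leq_trans (count_size _ _)) // size_tuple.
Qed.

Lemma sumn_mpart n (m : 'X_{1..n}) : sumn (mpart m) = mdeg m.
Proof.
rewrite /mdeg -sumnE (perm_sumn (perm_mpart m)).
by rewrite [X in _ = sumn X]val_mon ?size_mpart // sumn_cat sumn_nseq mul0n addn0.
Qed.

Lemma mpart_mon n (lam : intpart) : (size lam <= n)%N -> mpart (mon n lam) = lam.
Proof.
move=> szl; apply: val_inj => /=; rewrite [X in filter _ X]val_mon // filter_cat.
have -> : [seq k <- nseq (n - size lam) 0%N | k != 0%N] = [::].
  by apply/eqP; rewrite -size_eq0 size_filter count_nseq mul0n.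
case: lam szl => s /= /andP[sorted_s s0] szs; rewrite cats0.
have -> : [seq k <- s | k != 0%N] = s.
  by apply/all_filterP/allP => k ks; apply: contraNneq s0 => <-.
apply: sorted_sort => // a b c /= le1 le2; exact: leq_trans le2 le1.
Qed.

Lemma size_le_sumn (lam : intpart) : (size lam <= sumn lam)%N.
Proof.
case: lam => s /= /andP[_]; elim: s => //= x s IHs; rewrite inE negb_or.
by case/andP=> x_neq0 /IHs; move: x_neq0; lia.
Qed.

Lemma perm_mnm n (m m' : 'X_{1..n}) : perm_eq m m' ->
  exists s : 'S_n, m = [multinom m' (s i) | i < n].
Proof.
move=> /tuple_permP[s eq_m]; exists s.
apply/mnmP => i; rewrite mnmE !(mnm_nth 0%N) eq_m (nth_map i) ?size_enum_ord //.
by rewrite nth_ord_enum (tnth_nth 0%N).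
Qed.

Section SchurExpansion.

Variable R : idomainType.
Implicit Types (F : symser R) (lam mu : intpart).

Lemma symser_perm F n (m m' : 'X_{1..n}) : perm_eq m m' -> F n m = F n m'.
Proof.
by case/perm_mnm => s ->; rewrite ss_sym.
Qed.

Lemma symser_mon F n N s : (size s <= n)%N -> (n <= N)%N ->
  F N (mon N s) = F n (mon n s).
Proof.
move=> szs /subnKC<-; elim: (N - n)%N => [|k IHk]; first by rewrite addn0.
by rewrite addnS -mnmwiden_mon ?ss_stable ?IHk // (leq_trans szs) ?leq_addr.
Qed.

Lemma symser_mpart F n (m : 'X_{1..n}) N : (size (mpart m) <= N)%N ->
  F n m = F N (mon N (mpart m)).
Proof.
move=> szN; rewrite (symser_perm F (perm_mpart m)).
by rewrite !(symser_mon F (leqnn (size (mpart m)))) ?size_mpart.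
Qed.

Section Coef.
Variable f : symfun R.

Fact symser_of_sym n (s : 'S_n) (m : 'X_{1..n}) :
  (f n)@_[multinom m (s i) | i < n] = (f n)@_m.
Proof. exact: msym_coeff (sf_sym f n). Qed.

Fact symser_of_stable n (m : 'X_{1..n}) : (f n.+1)@_(mnmwiden m) = (f n)@_m.
Proof. by rewrite -mcoeff_restr sf_stable. Qed.

Definition symser_of : symser R := @SymSer R (fun n m => (f n)@_m)
  symser_of_sym symser_of_stable.
End Coef.

Lemma schur_coef_eq0 lam n (m : 'X_{1..n}) : sumn lam != mdeg m ->
  (schur R lam n)@_m = 0.
Proof. by move=> neq; rewrite (dhomog_nemf_coeff (schur_dhomog R lam n)) // eq_sym. Qed.

(** With as many variables as parts, s_lambda is x_1 ... x_l times the function of lambda with every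
    part lowered by 1, so it dies when the last variable is set to 0. The lowered list may contain
    zeros, hence [JT] on plain lists. *)
Lemma schur_small lam n : (n < size lam)%N -> schur R lam n = 0.
Proof.
move=> lt_n; suff: forall k, schur R lam ((size lam).-1 - k)%N = 0.
  by move=> /(_ ((size lam).-1 - n)%N); rewrite subKn //; case: (size lam) lt_n.
elim=> [|k IHk]; last first.
  have [lt_k|le_k] := ltnP k (size lam).-1; last first.
    by move: IHk; rewrite (eqP le_k) (eqP (leqW le_k)).
  by rewrite -(subnSK lt_k) in IHk; rewrite -(sf_stable (schur R lam)) IHk rmorph0.
rewrite subn0; case Elam: (size lam) lt_n => [//|N] _ /=.
rewrite -(sf_stable (schur R lam)).
have -> : schur R lam N.+1 = (\prod_i ev i 'X) * JT R (map predn lam) (size (map predn lam)) N.+1.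
  apply: (mulfI (vdm_neq0 R N.+1)); rewrite vdm_schur ?Elam // mulrCA.
  rewrite vdm_JT ?size_map ?Elam // alt_prodM; apply: eq_alt => j.
  rewrite -exprS; congr ('X ^+ _); rewrite /ed (nth_map 0%N) ?Elam //.
  by have := nth_part_gt0 lam j; rewrite Elam ltn_ord; lia.
by rewrite rmorphM rmorph_prod big_ord_recr /= evX restr_max mulr0 mul0r.
Qed.

Lemma schur_series_coef (b : intpart -> R) F lam n : (size lam <= n)%N ->
  schur_series b F -> b lam = smul (vdm R n) (F n) (edm n lam).
Proof.
move=> szl bF; set K := mdeg (edm n lam).
have /fin_all_exists[S0 S0P] (m : 'X_{1..n < K.+1}) := bF n m.
(* Large enough for every monomial up to degree [K] at once; [lam] is added so that its term is
   present. *)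
pose S := ([fset lam] `|` \bigcup_(m <- enum {: 'X_{1..n < K.+1}}) S0 m)%fset.
pose P := \sum_(mu <- S) b mu *: schur R mu n.
rewrite (@smulE _ _ _ _ P) => [|m]; last first.
  rewrite -ltnS => lt_mK; rewrite raddf_sum /=.
  rewrite -(S0P (BMultinom lt_mK) S) /=.
    by apply: eq_bigr => mu _; rewrite mcoeffZ.
  apply/fsubsetP => mu mu_in; rewrite inE; apply/orP; right.
  by apply/bigfcupP; exists (BMultinom lt_mK); rewrite ?mem_enum.
rewrite mulr_sumr raddf_sum /= (big_fsetD1 lam) ?inE ?eqxx //=.
rewrite -scalerAr mcoeffZ vdm_schur // alt_coef_monomial // eqxx mulr1.
rewrite big_seq big1 ?addr0 // => mu; rewrite !inE => /andP[neq_mu _].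
rewrite -scalerAr mcoeffZ; have [szm|lt_m] := leqP (size mu) n.
  by rewrite vdm_schur // alt_coef_monomial // (negPf neq_mu) mulr0.
by rewrite schur_small // mulr0 mcoeff0 mulr0.
Qed.

(** A list, since [intpart] is not a finite type; d variables suffice because a partition of d has
    at most d parts. *)
Definition partsn d : seq intpart :=
  undup [seq mpart (bmnm m) | m <- [seq m <- enum {: 'X_{1..d < d.+1}} | mdeg (bmnm m) == d]].

Lemma mem_partsn d lam : (lam \in partsn d) = (sumn lam == d).
Proof.
rewrite mem_undup; apply/mapP/eqP => [[m]|sum_d].
  by rewrite mem_filter => /andP[/eqP deg_m _] ->; rewrite sumn_mpart.
have szl : (size lam <= d)%N by rewrite -sum_d size_le_sumn.
have degd : mdeg (mon d lam) = d by rewrite -sumn_mpart mpart_mon.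
have ltd : (mdeg (mon d lam) < d.+1)%N by rewrite degd.
exists (BMultinom ltd); last by rewrite /= mpart_mon.
by rewrite mem_filter /= degd eqxx mem_enum.
Qed.

(* K expands Schur polynomials into monomial ones and E extracts Schur
   coefficients from the latter; K E = 1, and both matrices are square. *)
Lemma schur_solve F d : exists b : intpart -> R, forall mu, sumn mu = d ->
  \sum_(lam <- partsn d) b lam * (schur R lam d)@_(mon d mu) = F d (mon d mu).
Proof.
pose q := size (partsn d); pose pt (i : 'I_q) := tnth (in_tuple (partsn d)) i.
have ptP i : sumn (pt i) = d by apply/eqP; rewrite -mem_partsn mem_tnth.
have pt_size i : (size (pt i) <= d)%N by rewrite -[leqRHS](ptP i) size_le_sumn.
have pt_inj : injective pt.
  move=> i j; rewrite /pt !(tnth_nth (rowp 0)) /= => /eqP.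
  by rewrite nth_uniq ?undup_uniq // => /eqP/val_inj.
have pt_ex mu : sumn mu = d -> exists i, mu = pt i.
  move=> sum_mu; have : mu \in in_tuple (partsn d) by rewrite /= mem_partsn sum_mu.
  by case/tnthP => i ->; exists i.
(* The monomial symmetric polynomial of [pt j]. *)
pose M (j : 'I_q) : {mpoly R[d]} :=
  \sum_(m : 'X_{1..d < d.+1}) (mpart (bmnm m) == pt j)%:R *: 'X_[m].
have M_coef j m : (M j)@_m = (mpart m == pt j)%:R.
  have [le_md|lt_dm] := leqP (mdeg m) d.
    by rewrite (mcoeff_mpoly (fun m => (mpart m == pt j)%:R)).
  have -> : (mpart m == pt j) = false.
    by apply/eqP => /(congr1 (fun lam : intpart => sumn lam)); rewrite sumn_mpart ptP; lia.
  rewrite raddf_sum /= big1 // => k _; rewrite mcoeffZ mcoeffX.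
  case: (bmnm k =P m) => [eq_k|_]; last by rewrite mulr0.
  by have := bmdeg k; rewrite eq_k; lia.
pose K := \matrix_(i < q, j < q) (schur R (pt i) d)@_(mon d (pt j)).
pose E := \matrix_(j < q, i < q) (vdm R d * M j)@_(edm d (pt i)).
have schurM i : schur R (pt i) d = \sum_j K i j *: M j.
  apply/mpolyP => m; rewrite raddf_sum /=.
  have [eq_d|neq_d] := eqVneq (mdeg m) d; last first.
    rewrite schur_coef_eq0 ?ptP 1?eq_sym // big1 // => j _.
    rewrite mcoeffZ M_coef; case: eqP => [eq_m|_]; last by rewrite mulr0.
    by case/eqP: neq_d; rewrite -sumn_mpart eq_m ptP.
  have [j eq_j] : exists j, mpart m = pt j by apply: pt_ex; rewrite sumn_mpart.
  rewrite (bigD1 j) //= mcoeffZ M_coef eq_j eqxx mulr1 big1 ?addr0 => [|l neq_l].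
    have := @symser_mpart (symser_of (schur R (pt i))) d m d (size_mpart m).
    by rewrite eq_j mxE.
  by rewrite mcoeffZ M_coef eq_j (inj_eq pt_inj) eq_sym (negPf neq_l) mulr0.
have KE : K *m E = 1%:M.
  apply/matrixP => i l; rewrite !mxE.
  have -> : \sum_j K i j * E j l = (vdm R d * schur R (pt i) d)@_(edm d (pt l)).
    rewrite schurM mulr_sumr raddf_sum /=; apply: eq_bigr => j _.
    by rewrite -scalerAr mcoeffZ !mxE.
  by rewrite vdm_schur // alt_coef_monomial // (inj_eq pt_inj).
pose phi : 'rV_q := \row_j F d (mon d (pt j)).
have [b bP] : exists b : intpart -> R, forall i, b (pt i) = (phi *m E) 0 i.
  exists (fun lam => if [pick i | pt i == lam] is Some i then (phi *m E) 0 i else 0).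
  by move=> i; case: pickP => [j /eqP/pt_inj-> //|/(_ i)]; rewrite eqxx.
exists b => mu /pt_ex[j ->].
(* With b = phi E, the product b K is phi (E K), and K E = 1 implies E K = 1 for square matrices. *)
have := congr1 (fun A : 'rV_q => A 0 j) (mulmxA phi E K).
rewrite (mulmx1C KE) mulmx1 !mxE => ->.
rewrite (big_tnth _ _ (partsn d)); apply: eq_bigr => i _.
by rewrite bP [K i j]mxE.
Qed.

Lemma schur_series_exists F : exists b, schur_series b F.
Proof.
have [b bP] : exists b : nat -> intpart -> R, forall d mu, sumn mu = d ->
    \sum_(lam <- partsn d) b d lam * (schur R lam d)@_(mon d mu) = F d (mon d mu).
  exists (fun d => epsilon (inhabits (fun=> 0)) (fun b => forall mu, sumn mu = d ->
    \sum_(lam <- partsn d) b lam * (schur R lam d)@_(mon d mu) = F d (mon d mu))) => d.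
  exact: epsilon_spec (inhabits (fun=> 0)) _ (schur_solve F d).
(* The solutions of the separate degrees are glued: only partitions of size deg m contribute at m.
   The values transfer from n to deg m variables because m has at most deg m nonzero exponents. *)
exists (fun lam => b (sumn lam) lam) => n m; exists [fset lam | lam in partsn (mdeg m)]%fset.
move=> S subS; set d := mdeg m in subS.
have coefE lam : sumn lam = d ->
    (schur R lam n)@_m = (schur R lam d)@_(mon d (mpart m)).
  move=> sum_lam; apply: (@symser_mpart (symser_of (schur R lam))).
  by rewrite /d -sumn_mpart size_le_sumn.
rewrite (@symser_mpart F n m d); last by rewrite /d -sumn_mpart size_le_sumn.
rewrite -(bP d) ?sumn_mpart // -(big_fset_incl _ subS) => [|lam _]; last first.
  rewrite !inE mem_partsn => neq_d.
  by rewrite schur_coef_eq0 ?mulr0.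
have -> : \sum_(lam <- [fset lam | lam in partsn d]%fset)
    b (sumn lam) lam * (schur R lam n)@_m =
    \sum_(lam <- partsn d) b (sumn lam) lam * (schur R lam n)@_m.
  apply: perm_big; apply: uniq_perm; rewrite ?fset_uniq ?undup_uniq // => lam.
  by rewrite !inE.
rewrite !big_seq; apply: eq_bigr => lam; rewrite mem_partsn => /eqP sum_lam.
by rewrite sum_lam coefE.
Qed.

Lemma schur_scoordP F : schur_series (schur_scoord F) F.
Proof. exact: epsilon_spec (inhabits (fun=> 0)) _ (schur_series_exists F). Qed.

Lemma schur_scoordE F lam n : (size lam <= n)%N ->
  schur_scoord F lam = smul (vdm R n) (F n) (edm n lam).
Proof. by move=> szl; apply: schur_series_coef szl (schur_scoordP F). Qed.

Lemma big_finsupp (V : zmodType) (x : intpart -> R -> V)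
    (c : {fsfun intpart -> R with 0}) (S : {fset intpart}) :
  (forall lam, x lam 0 = 0) -> (finsupp c `<=` S)%fset ->
  \sum_(lam <- finsupp c) x lam (c lam) = \sum_(lam <- S) x lam (c lam).
Proof.
move=> x0 subS; apply: big_fset_incl subS _ => lam _ lam_notin.
by rewrite fsfun_dflt.
Qed.

(** The coordinates in the completion are cut to sizes below a degree bound of f, which leaves
    finitely many. *)
Lemma schur_sum_exists (f : symfun R) : exists c, f = schur_sum c.
Proof.
have [D szf] := sf_bounded f; pose b := schur_scoord (symser_of f).
pose S := [fset lam | lam in flatten [seq partsn d | d <- iota 0 D]]%fset.
have memS lam : (lam \in S) = (sumn lam < D)%N.
  rewrite !inE /=; apply/flatten_mapP/idP => [[d]|lt_D].
    by rewrite mem_iota mem_partsn => lt_d /eqP->.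
  by exists (sumn lam); rewrite ?mem_iota ?mem_partsn.
pose c : {fsfun intpart -> R with 0} := [fsfun lam in S => b lam].
exists c.
rewrite /schur_sum (@big_finsupp _ (fun lam c => c *: schur R lam) _ S); last first.
- exact: finsupp_sub.
- by move=> lam; rewrite scale0r.
apply: symfunP => n; apply/mpolyP => m.
have -> : (\sum_(lam <- S) c lam *: schur R lam) n =
    \sum_(lam <- S) b lam *: schur R lam n.
  rewrite -[LHS]/(sfev n _) rmorph_sum; apply: eq_big_seq => lam lamS.
  by rewrite fsfunE lamS.
rewrite raddf_sum /=; under eq_bigr do rewrite mcoeffZ.
have [le_D|lt_D] := leqP D (mdeg m).
  rewrite memN_msupp_eq0; last by apply: msize_mdeg_ge; apply: leq_trans le_D.
  rewrite big_seq big1 // => lam; rewrite memS => lt_D.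
  by rewrite schur_coef_eq0 ?mulr0 //; lia.
have [S0 S0P] := schur_scoordP (symser_of f) m.
rewrite -[LHS]/(symser_of f n m) -(S0P (S0 `|` S)%fset) ?fsubsetUl //.
rewrite -(big_fset_incl _ (fsubsetUr S0 S)) // => lam _; rewrite memS => nlt_D.
by rewrite schur_coef_eq0 ?mulr0 //; lia.
Qed.

Lemma schur_coordP (f : symfun R) : f = schur_sum (schur_coord f).
Proof. exact: epsilon_spec (inhabits [fsfun]) _ (schur_sum_exists f). Qed.

Lemma schur_coordE (f : symfun R) lam n : (size lam <= n)%N ->
  schur_coord f lam = (vdm R n * f n)@_(edm n lam).
Proof.
move=> szl; set S := (lam |` finsupp (schur_coord f))%fset.
have -> : f n = \sum_(mu <- S) schur_coord f mu *: schur R mu n.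
  rewrite {1}[f]schur_coordP /schur_sum.
  rewrite (@big_finsupp _ (fun mu c => c *: schur R mu) _ S) ?fsubsetU1 //.
    by rewrite -[LHS]/(sfev n _) rmorph_sum.
  by move=> mu; rewrite scale0r.
rewrite mulr_sumr raddf_sum /= (big_fsetD1 lam) ?inE ?eqxx //=.
rewrite -scalerAr mcoeffZ vdm_schur // alt_coef_monomial // eqxx mulr1.
rewrite big_seq big1 ?addr0 // => mu; rewrite !inE => /andP[neq_mu _].
rewrite -scalerAr mcoeffZ; have [szm|lt_m] := leqP (size mu) n.
  by rewrite vdm_schur // alt_coef_monomial // (negPf neq_mu) mulr0.
by rewrite schur_small // mulr0 mcoeff0 mulr0.
Qed.

End SchurExpansion.

(** * The functions G *)

Section Grothendieck.

Variable R : idomainType.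

Lemma restr_ev_widen n (i : 'I_n) (u : {poly R}) :
  restr (ev (widen_ord (leqnSn n) i) u) = ev i u.
Proof.
rewrite !(@evE _ _ _ _ (size u)) // rmorph_sum; apply: eq_bigr => k _.
by rewrite /= restrZ rmorphXn /= restr_widen.
Qed.

Lemma restr_ev_max n (u : {poly R}) :
  restr (ev (@ord_max n) u) = (u`_0)%:MP.
Proof.
rewrite (@evE _ _ _ _ (size u).+1) // rmorph_sum big_ord_recl big1 ?addr0 => [|k _].
  by rewrite /= restrZ rmorph1 -mul_mpolyC mulr1.
by rewrite /= restrZ rmorphXn /= restr_max expr0n scaler0.
Qed.

Lemma restr_vdm n : restr (vdm R n.+1) = (\prod_(i < n) 'X_i) * vdm R n.
Proof.
rewrite /vdm rmorph_prod big_ord_recr /= [X in _ * restr X]big_pred0; last first.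
  by move=> j; rewrite ltnNge -ltnS ltn_ord.
rewrite rmorph1 mulr1 -big_split /=; apply: eq_bigr => i _.
rewrite big_mkcond big_ord_recr rmorphM /= ltn_ord rmorphB /= restr_max subr0 restr_widen mulrC.
congr (_ * _); rewrite rmorph_prod [RHS]big_mkcond /=; apply: eq_bigr => j _.
by case: ifP => _; rewrite ?rmorph1 // rmorphB /= !restr_widen.
Qed.

Lemma horner0_1DZX (c : R) : (1 + c *: 'X).[0] = 1.
Proof. by rewrite hornerD hornerZ hornerX hornerC mulr0 addr0. Qed.

Lemma horner0_1BZX (c : R) : (1 - c *: 'X).[0] = 1.
Proof. by rewrite -scaleNr horner0_1DZX. Qed.

Lemma ev_1DZX n (i : 'I_n) (c : R) : ev i (1 + c *: 'X) = 1 + c *: 'X_i.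
Proof. by rewrite evD ev1 evZ evX. Qed.

Lemma ev_1BZX n (i : 'I_n) (c : R) : ev i (1 - c *: 'X) = 1 - c *: 'X_i.
Proof. by rewrite evB ev1 evZ evX. Qed.

Lemma mcoeff_exp_eq0 n (E : {mpoly R[n]}) k m : E@_0%MM = 0 -> (mdeg m < k)%N ->
  (E ^+ k)@_m = 0.
Proof.
move=> E0; elim: k m => // k IHk m; rewrite ltnS => le_mk.
rewrite exprS mcoeffM big1 // => -[k1 k2] /= /eqP eq_m.
have [->|nz] := eqVneq (bmnm k1) 0%MM; first by rewrite E0 mul0r.
rewrite IHk ?mulr0 //.
have := mdegD k1 k2; rewrite -eq_m; move: nz le_mk; rewrite -mdeg_eq0.
lia.
Qed.

Lemma geom_trunc n (D p : {mpoly R[n]}) K : D@_0%MM = 1 ->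
  eqtrunc K (D * (p * \sum_(k < K.+1) (1 - D) ^+ k)) p.
Proof.
move=> D0 m le_mK; rewrite mulrCA.
have -> : D * \sum_(k < K.+1) (1 - D) ^+ k = 1 - (1 - D) ^+ K.+1.
  rewrite -[RHS]opprB subrX1 (_ : 1 - D - 1 = - D) ?mulNr ?opprK //.
  by rewrite addrAC subrr add0r.
have : eqtrunc K (1 - (1 - D) ^+ K.+1) 1.
  move=> m' le_m'; rewrite mcoeffB mcoeff_exp_eq0 ?subr0 //.
  by rewrite mcoeffB mcoeff1 eqxx D0 subrr.
by move=> /(eqtruncMl p)/(_ _ le_mK); rewrite mulr1.
Qed.

Variables (a b : R) (mu : intpart).

Local Notation L := (nth 0%N mu 0).

(** Column j of the numerator over the common denominator (1 - a t)^L, where L is the largest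
    part. *)
Definition Gnum n (j : 'I_n) : {poly R} :=
  'X^(ed mu j) * ((1 + b *: 'X) ^+ j * (1 - a *: 'X) ^+ (L - nth 0%N mu j)).

(** The quotient of the alternant of [Gnum] by the Vandermonde determinant, read off from [alt_vdm]
    without a division. *)
Definition Gnumer n : {mpoly R[n]} :=
  sfev n (\det (\matrix_(s < n, j < n) hpoly (@Gnum n j) (n - s.+1))).

Lemma vdm_Gnumer n : vdm R n * Gnumer n = alt (@Gnum n).
Proof. by rewrite alt_vdm. Qed.

Definition Gden n : {mpoly R[n]} := \prod_(i < n) ev i ((1 - a *: 'X) ^+ L).

Lemma mcoeff0_Gden n : (Gden n)@_0%MM = 1.
Proof.
rewrite mcoeff_prod_ev big1 // => i _; rewrite mnm0E -!horner_coef0.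
by rewrite horner_exp horner0_1BZX expr1n.
Qed.

Lemma Gden_neq0 n : Gden n != 0.
Proof.
apply/eqP => D0; have := mcoeff0_Gden n; rewrite D0 mcoeff0 => /eqP.
by rewrite eq_sym oner_eq0.
Qed.

Lemma GfracE n : Gfrac a b mu n = tofrac (Gnumer n) / tofrac (Gden n).
Proof.
rewrite /Gfrac; set A := matrix_of_fun _ _; set V := \prod_i _.
have -> : V = tofrac (vdm R n).
  by rewrite rmorph_prod; apply: eq_bigr => i _; rewrite rmorph_prod.
have detA : tofrac (Gden n) * \det A = tofrac (alt (@Gnum n)).
  pose D : 'M_n := diag_mx (\row_i tofrac (ev i ((1 - a *: 'X) ^+ L))).
  have -> : tofrac (Gden n) = \det D.
    by rewrite det_diag rmorph_prod; apply: eq_bigr => i _; rewrite mxE.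
  rewrite -det_mulmx -det_map_mx; congr (\det _); apply/matrixP => i j.
  rewrite mul_diag_mx !mxE /Gnum !evM !ev_exp evX ev_1DZX ev_1BZX.
  have nz : tofrac ((1 - a *: ('X_i : {mpoly R[n]})) ^+ nth 0%N mu j) != 0.
    rewrite tofrac_eq0 expf_neq0 //; apply/eqP => /(congr1 (mcoeff 0%MM))/eqP.
    by rewrite mcoeffB mcoeff1 mcoeffZ mcoeffX mnm1_eq0 mulr0 subr0 mcoeff0 eqxx oner_eq0.
  rewrite -{1}(subnK (nth_part_mono mu (leq0n j))) exprD rmorphM /=.
  rewrite -mulrA [X in _ * X]mulrCA divff // mulr1 -rmorphM; congr tofrac.
  by rewrite mulrC mulrA.
have nzD : tofrac (Gden n) != 0 by rewrite tofrac_eq0 Gden_neq0.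
have nzV : tofrac (vdm R n) != 0 by rewrite tofrac_eq0 vdm_neq0.
rewrite -vdm_Gnumer rmorphM /= in detA.
by apply/eqP; rewrite (eqr_div _ _ nzV nzD) mulrC detA mulrC eqxx.
Qed.

Lemma Gden_sym n : Gden n \is symmetric.
Proof.
apply/issymP => s; rewrite /Gden rmorph_prod /= [RHS](reindex_inj (@perm_inj _ s)) /=.
apply: eq_bigr => i _; rewrite !ev_exp rmorphXn /= !ev_1BZX.
rewrite msymB msym1 msymZ msymX; congr ((1 - _ *: 'X_[_]) ^+ _).
by apply/mnmP => k; rewrite mnmE !mnm1E -(inj_eq (@perm_inj _ s)) permKV.
Qed.

Lemma restr_Gden n : restr (Gden n.+1) = Gden n.
Proof.
rewrite /Gden rmorph_prod big_ord_recr /= restr_ev_max -horner_coef0.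
rewrite horner_exp horner0_1BZX expr1n mpolyC1 mulr1.
by apply: eq_bigr => i _; rewrite restr_ev_widen.
Qed.

(** With the last variable at 0, the last row of the alternant keeps only its corner 1, and the
    remaining columns gain a factor t. The resulting x_1 ... x_n is also what the Vandermonde
    determinant gains. *)
Lemma restr_Gnumer n : (size mu <= n)%N -> restr (Gnumer n.+1) = Gnumer n.
Proof.
move=> szm; have nz : restr (vdm R n.+1) != 0.
  rewrite restr_vdm mulf_neq0 ?vdm_neq0 //; apply/prodf_neq0 => i _.
  by rewrite -msize_poly_eq0 msizeX.
apply: (mulfI nz); rewrite -rmorphM vdm_Gnumer restr_vdm -mulrA vdm_Gnumer.
have -> : \prod_(i < n) ('X_i : {mpoly R[n]}) = \prod_(i < n) ev i 'X.
  by apply: eq_bigr => i _; rewrite evX.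
rewrite alt_prodM /alt -det_map_mx (expand_det_row _ ord_max) big_ord_recr /=.
rewrite big1 ?add0r => [|j _]; last first.
  rewrite !mxE restr_ev_max /Gnum coefXnM /ed /=.
  by rewrite ifT ?mpolyC0 ?mul0r //; have := ltn_ord j; lia.
have -> : ((\matrix_(i < n.+1, j < n.+1) ev i (Gnum j)) ^ restr (n:=n))%sesqui ord_max ord_max = 1.
  rewrite !mxE restr_ev_max /Gnum /ed [nth 0%N mu ord_max]nth_default // add0n.
  rewrite subnn -horner_coef0.
  rewrite !hornerM !horner_exp horner0_1DZX horner0_1BZX.
  by rewrite expr0 !expr1n !mul1r mpolyC1.
rewrite mul1r /cofactor -signr_odd oddD addbb mul1r; congr (\det _).
apply/matrixP => i j; rewrite !mxE.
have liftE (k : 'I_n) : lift ord_max k = widen_ord (leqnSn n) k.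
  by apply: val_inj; rewrite [LHS]lift_max.
rewrite !liftE restr_ev_widen; congr (ev i _); rewrite /Gnum mulrA -exprS /ed /=.
by congr ('X^_ * _); rewrite -addnS subSS subnSK.
Qed.

(** [Gnumer] / [Gden] up to degree [K], by the geometric series in 1 - [Gden]. *)
Definition Gpart n K : {mpoly R[n]} := Gnumer n * \sum_(k < K.+1) (1 - Gden n) ^+ k.

Definition Gcoef n (m : 'X_{1..n}) : R := (Gpart n (mdeg m))@_m.

Lemma Gpart_sym n K : Gpart n K \is symmetric.
Proof.
rewrite rpredM ?sf_sym // rpred_sum // => k _.
by rewrite rpredX // rpredB ?rpred1 ?Gden_sym.
Qed.

Lemma Gcoef_perm n (m m' : 'X_{1..n}) : perm_eq m m' -> Gcoef m = Gcoef m'.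
Proof.
case/perm_mnm => s ->; rewrite /Gcoef mdeg_mperm.
exact: msym_coeff (Gpart_sym n _).
Qed.

Lemma Gcoef_stable n (m : 'X_{1..n}) : (size mu <= n)%N ->
  Gcoef (mnmwiden m) = Gcoef m.
Proof.
move=> szm; rewrite /Gcoef -mcoeff_restr.
have -> : mdeg (mnmwiden m) = mdeg m.
  by rewrite !mdegE big_ord_recr /= mnmwiden_ordmax addn0;
    apply: eq_bigr => i _; rewrite mnmwiden_widen.
rewrite /Gpart rmorphM /= restr_Gnumer // rmorph_sum /=.
by under eq_bigr do rewrite rmorphXn rmorphB rmorph1 /= restr_Gden.
Qed.

Lemma Gcoef_mon n N s : (size mu <= n)%N -> (size s <= n)%N -> (n <= N)%N ->
  Gcoef (mon N s) = Gcoef (mon n s).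
Proof.
move=> szm szs /subnKC<-; elim: (N - n)%N => [|k IHk]; first by rewrite addn0.
rewrite addnS -mnmwiden_mon ?(leq_trans szs) ?leq_addr //.
by rewrite Gcoef_stable // (leq_trans szm) ?leq_addr.
Qed.

(** [Gcoef] is stable only from [size mu] variables on; padding with zeros reaches that range for
    every n. *)
Definition Gser n (m : 'X_{1..n}) : R := Gcoef (mon (n + size mu) m).

Fact Gser_sym n (s : 'S_n) (m : 'X_{1..n}) :
  Gser [multinom m (s i) | i < n] = Gser m.
Proof.
apply: Gcoef_perm; rewrite !val_mon ?size_tuple ?leq_addr // perm_cat2r.
by apply/tuple_permP; exists s; apply: eq_map => i; rewrite mnm_tnth.
Qed.

Fact Gser_stable n (m : 'X_{1..n}) : Gser (mnmwiden m) = Gser m.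
Proof.
rewrite /Gser -(@Gcoef_mon (n + size mu) (n.+1 + size mu)) ?leq_addl ?leq_add2r //.
  congr Gcoef; apply/mnmP => i; rewrite !mnmE /= nth_rcons size_tuple.
  by case: ltnP => // le_n; rewrite if_same nth_default ?size_tuple.
by rewrite size_tuple leq_addr.
Qed.

Definition Gsymser : symser R := SymSer Gser_sym Gser_stable.

Lemma GsymserE n (m : 'X_{1..n}) : (size mu <= n)%N -> Gsymser n m = Gcoef m.
Proof.
move=> szm; rewrite [LHS](@Gcoef_mon n) ?leq_addr ?size_tuple //.
by congr Gcoef; apply/mnmP => i; rewrite mnmE -mnm_nth.
Qed.

Lemma Gsymser_is_G : is_G a b mu Gsymser.
Proof.
move=> n _ szm; exists (Gnumer n), (Gden n); split; first exact: mcoeff0_Gden.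
  exact: GfracE.
move=> m; rewrite -[LHS]/(smul (Gden n) (Gsymser n) m).
rewrite (@smulE _ _ _ _ (Gpart n (mdeg m))) => [|m' le_m'].
  exact: geom_trunc (mcoeff0_Gden n) _ _.
(* The series was cut at deg m', here the cut is at deg m; up to degree deg m' both are the quotient
   of [Gnumer] by [Gden]. *)
rewrite GsymserE //; apply: (eqtrunc_cancel (mcoeff0_Gden n)) (leqnn _).
apply: (eqtrunc_trans (geom_trunc _ (mcoeff0_Gden n))) => m2 le_m2.
by rewrite [RHS](geom_trunc _ (mcoeff0_Gden n)) // (leq_trans le_m2).
Qed.

Lemma GP : is_G a b mu (G a b mu).
Proof. exact: epsilon_spec (inhabits (symser0 R)) _ (ex_intro _ _ Gsymser_is_G). Qed.

(* The inverse of 1 - a t modulo t^(K + 1). *)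
Definition ginv K : {poly R} := \sum_(k < K.+1) (a *: 'X) ^+ k.

Lemma ginvP K l : exists v, ((1 - a *: 'X) * ginv K) ^+ l = 1 + 'X^(K.+1) * v.
Proof.
have -> : (1 - a *: 'X) * ginv K = 1 - a ^+ K.+1 *: 'X^(K.+1).
  by rewrite -exprZn -[RHS]opprB subrX1 -mulNr opprB.
elim: l => [|l [v IHl]]; first by exists 0; rewrite mulr0 addr0.
exists (v - (a ^+ K.+1)%:P * (1 + 'X^(K.+1) * v)).
by rewrite exprS IHl -mul_polyC; ring.
Qed.

Lemma ginv_coef K l (p : {poly R}) k : (k <= K)%N ->
  (((1 - a *: 'X) * ginv K) ^+ l * p)`_k = p`_k.
Proof.
move=> le_kK; have [v ->] := ginvP K l.
by rewrite mulrDl mul1r -mulrA coefD coefXnM ltnS le_kK addr0.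
Qed.

Lemma ginv0 K : (ginv K)`_0 = 1.
Proof.
have := @ginv_coef K 1 1 0 (leq0n _); rewrite mulr1 expr1 coef1 coefM big_ord1.
by rewrite coefB coef1 coefZ coefX mulr0 subr0 mul1r.
Qed.

(** Up to degree [K], Vandermonde times G times [Gden] is the alternant of [Gnum], and the powers of
    [ginv] absorb [Gden] column by column. *)
Lemma scoordG_alt (lam : intpart) n K :
  (0 < n)%N -> (size mu <= n)%N -> (size lam <= n)%N -> (mdeg (edm n lam) <= K)%N ->
  schur_scoord (G a b mu) lam =
    (alt (fun j : 'I_n => ginv K ^+ L * Gnum j))@_(edm n lam).
Proof.
move=> n_gt0 szm szl le_K; have [p [d [d0 eq_pd dF]]] := GP n_gt0 szm.
set F := G a b mu in dF *; pose P := trunc K (F n).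
have FP m : (mdeg m <= K)%N -> F n m = P@_m by move=> le_m; rewrite mcoeff_trunc.
rewrite (schur_scoordE F szl) (@smulE _ _ _ _ P) => [|m le_m]; last first.
  by apply: FP; apply: leq_trans le_K.
have dP : eqtrunc K (d * P) p.
  move=> m le_m; rewrite -dF -[RHS]/(smul d (F n) m) (@smulE _ _ _ _ P) // => m' le_m'.
  by rewrite FP // (leq_trans le_m').
have d_neq0 : d != 0.
  by apply/eqP => d_eq0; move: d0; rewrite d_eq0 mcoeff0 => /esym/eqP; rewrite oner_eq0.
(* The fraction p / d supplied by [expansion] is arbitrary; cross-multiplying ties it to [Gnumer]
   and [Gden]. *)
have pD : p * Gden n = d * Gnumer n.
  apply/eqP; rewrite -tofrac_eq !rmorphM /=.
  have := GfracE n; rewrite eq_pd => /eqP.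
  have nzd : tofrac d != 0 by rewrite tofrac_eq0.
  have nzD : tofrac (Gden n) != 0 by rewrite tofrac_eq0 Gden_neq0.
  by rewrite (eqr_div _ _ nzd nzD) [X in _ == X]mulrC.
have PD : eqtrunc K (Gden n * (vdm R n * P)) (alt (@Gnum n)).
  rewrite -vdm_Gnumer mulrCA; apply: eqtruncMl; apply: (eqtrunc_cancel d0).
  by rewrite -pD mulrCA mulrC; apply: eqtruncM => // m le_m.
apply: (eqtrunc_cancel (mcoeff0_Gden n)) le_K.
(* Row i reads a coefficient of index m i, at most [K], where [ginv] is an exact inverse. *)
apply: eqtrunc_trans PD _ => m le_m; rewrite alt_prodM !mcoeff_alt; congr (\det _).
apply/matrixP => i j; rewrite !mxE mulrA -exprMn ginv_coef //.
by apply: leq_trans le_m; rewrite mdegE (bigD1 i) //= leq_addr.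
Qed.

Definition Grem n K (j : 'I_n) : {poly R} :=
  ginv K ^+ L * ((1 + b *: 'X) ^+ j * (1 - a *: 'X) ^+ (L - nth 0%N mu j)).

Lemma Grem0 n K (j : 'I_n) : (Grem K j)`_0 = 1.
Proof.
rewrite -horner_coef0 !hornerM !horner_exp horner0_1DZX horner0_1BZX.
by rewrite horner_coef0 ginv0 !expr1n !mulr1.
Qed.

Lemma scoordG_alt_rem (lam : intpart) n K :
  (0 < n)%N -> (size mu <= n)%N -> (size lam <= n)%N -> (mdeg (edm n lam) <= K)%N ->
  schur_scoord (G a b mu) lam =
    (alt (fun j : 'I_n => 'X^(ed mu j) * Grem K j))@_(edm n lam).
Proof.
move=> n_gt0 szm szl le_K; rewrite (scoordG_alt n_gt0 szm szl le_K).
by congr (_@__); apply: eq_alt => j; rewrite /Gnum mulrCA.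
Qed.

Lemma scoordG_contained (lam : intpart) : schur_scoord (G a b mu) lam != 0 ->
  forall i, (nth 0 mu i <= nth 0 lam i)%N.
Proof.
pose n := (maxn (size lam) (size mu)).+1.
have szl : (size lam <= n)%N by rewrite leqW // leq_maxl.
have szm : (size mu <= n)%N by rewrite leqW // leq_maxr.
rewrite (scoordG_alt_rem (ltn0Sn _) szm szl (leqnn _)).
move=> /alt_coef_contained contained i; have [lt_in|le_ni] := ltnP i n.
  exact: (contained (Ordinal lt_in)).
by rewrite [X in (X <= _)%N]nth_default // (leq_trans szm).
Qed.

Lemma scoordG_diag : schur_scoord (G a b mu) mu = 1.
Proof.
rewrite (scoordG_alt_rem (ltn0Sn (size mu)) (leqnSn _) (leqnSn _) (leqnn _)).
by rewrite alt_coef_diag // => j; rewrite Grem0.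
Qed.

End Grothendieck.

(** * Duality *)

Lemma sumn_nth (s : seq nat) n : (size s <= n)%N ->
  sumn s = (\sum_(i < n) nth 0 s i)%N.
Proof.
move=> le_sn; rewrite sumnE (big_nth 0%N) (big_nat_widen _ _ n) // big_mkord.
rewrite big_mkcond /=; apply: eq_bigr => i _.
by case: ifP => // /negbT; rewrite -leqNgt => /(nth_default 0%N).
Qed.

Lemma contained_sumn (lam mu : intpart) :
  (forall i, nth 0 mu i <= nth 0 lam i)%N -> mu != lam -> (sumn mu < sumn lam)%N.
Proof.
move=> contained; apply: contraNltn => le_sum; apply/eqP/intpart_eq => i.
pose n := (maxn i (maxn (size lam) (size mu))).+1.
have lt_in : (i < n)%N by rewrite ltnS leq_maxl.
have szl : (size lam <= n)%N by rewrite leqW // !leq_max leqnn orbT.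
have szm : (size mu <= n)%N by rewrite leqW // !leq_max leqnn !orbT.
have sumD1 (s : seq nat) : (\sum_(j < n) nth 0 s j =
    nth 0 s i + \sum_(j < n | j != Ordinal lt_in) nth 0 s j)%N.
  by rewrite (bigD1 (Ordinal lt_in)).
move: le_sum; rewrite (sumn_nth szl) (sumn_nth szm) !sumD1.
have : (\sum_(j < n | j != Ordinal lt_in) nth 0 mu j
        <= \sum_(j < n | j != Ordinal lt_in) nth 0 lam j)%N by apply: leq_sum.
by have := contained i; lia.
Qed.

Lemma rowp_eq (mu : intpart) : (size mu <= 1)%N -> mu = rowp (nth 0%N mu 0).
Proof.
move=> szm; apply: intpart_eq => i; rewrite /= nth_nseq.
case: i => [|i]; first by case: (nth 0%N mu 0).
by rewrite nth_default ?(leq_trans szm) //; case: ifP => //; case: (nth _ _ _).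
Qed.

Lemma size_colp k : size (colp k) = k. Proof. by rewrite size_nseq. Qed.

Lemma colp_eq (mu : intpart) : (nth 0%N mu 0 <= 1)%N -> mu = colp (size mu).
Proof.
move=> le1; apply: intpart_eq => i; rewrite /= nth_nseq -nth_part_gt0.
have := leq_trans (nth_part_mono mu (leq0n i)) le1.
by case: (nth 0%N mu i) => [|[]].
Qed.

Lemma colp_inj : injective colp.
Proof. by move=> i j /(congr1 (fun lam : intpart => size lam)); rewrite !size_colp. Qed.

Lemma conjp_row k : conjp (rowp k) = colp k.
Proof.
apply: intpart_eq => i; rewrite /= /conj_parts; case: k => [|k] //=.
rewrite -[RHS]/(nth 0%N (nseq k.+1 1%N) i) nth_nseq; have [lt_ik|le_ki] := ltnP i k.+1.
  by rewrite nth_mkseq //= lt_ik.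
by rewrite nth_default ?size_mkseq.
Qed.

Section Duality.

Variable R : idomainType.
Implicit Types (f : symfun R) (lam mu : intpart).

Lemma schur_coord_schur lam mu : schur_coord (schur R lam) mu = (lam == mu)%:R.
Proof.
have [szl|lt_l] := leqP (size lam) (size mu).
  by rewrite (schur_coordE _ (leqnn _)) vdm_schur // alt_coef_monomial.
rewrite (schur_coordE _ (leqnn _)) schur_small // mulr0 mcoeff0.
by case: eqP => // eq_lm; rewrite eq_lm ltnn in lt_l.
Qed.

Lemma schur_coordD f f' lam :
  schur_coord (f + f') lam = schur_coord f lam + schur_coord f' lam.
Proof. by rewrite !(schur_coordE _ (leqnn _)) mulrDr mcoeffD. Qed.

Lemma schur_coordZ c f lam : schur_coord (c *: f) lam = c * schur_coord f lam.
Proof. by rewrite !(schur_coordE _ (leqnn _)) -scalerAr mcoeffZ. Qed.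

Lemma schur_coord_sum I (r : seq I) (c : I -> R) (f : I -> symfun R) lam :
  schur_coord (\sum_(i <- r) c i *: f i) lam =
  \sum_(i <- r) c i * schur_coord (f i) lam.
Proof.
elim: r => [|i r IHr]; last by rewrite !big_cons schur_coordD schur_coordZ IHr.
by rewrite !big_nil -(scale0r 0) schur_coordZ mul0r.
Qed.

Section Linear.

Variables (V : zmodType) (x : intpart -> R -> V).
Hypothesis xD : forall lam, {morph x lam : c c' / c + c'}.

(** Common form of [hall], [omega] and [bar]. Only additivity in the coefficient is assumed, because
    [bar] is not linear over the coefficient ring. *)
Definition schur_ext f : V :=
  \sum_(lam <- finsupp (schur_coord f)) x lam (schur_coord f lam).

Let x0 lam : x lam 0 = 0.
Proof. by apply: (addrI (x lam 0)); rewrite -xD !addr0. Qed.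

Lemma schur_extD f f' : schur_ext (f + f') = schur_ext f + schur_ext f'.
Proof.
pose S := (finsupp (schur_coord (f + f')%R) `|`
  (finsupp (schur_coord f) `|` finsupp (schur_coord f')))%fset.
have s1 : (finsupp (schur_coord f) `<=` S)%fset.
  by rewrite fsubsetU // fsubsetUl orbT.
have s2 : (finsupp (schur_coord f') `<=` S)%fset.
  by rewrite fsubsetU // fsubsetUr orbT.
rewrite /schur_ext (big_finsupp x0 s1) (big_finsupp x0 s2).
rewrite (big_finsupp x0 (fsubsetUl _ _ : finsupp _ `<=` S)%fset).
by rewrite -big_split; apply: eq_bigr => lam _; rewrite schur_coordD xD.
Qed.

Lemma schur_extZ c lam : schur_ext (c *: schur R lam) = x lam c.
Proof.
rewrite /schur_ext (big_finsupp x0 (fsubsetU1 lam _)) (big_fsetD1 lam) ?inE ?eqxx //=.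
rewrite schur_coordZ schur_coord_schur eqxx mulr1 big_seq big1 ?addr0 // => mu.
rewrite !inE => /andP[neq _].
by rewrite schur_coordZ schur_coord_schur eq_sym (negPf neq) mulr0.
Qed.

Lemma schur_ext_sum I (r : seq I) (c : I -> R) (nu : I -> intpart) :
  schur_ext (\sum_(i <- r) c i *: schur R (nu i)) = \sum_(i <- r) x (nu i) (c i).
Proof.
elim: r => [|i r IHr]; last by rewrite !big_cons schur_extD schur_extZ IHr.
by rewrite !big_nil -(scale0r (schur R (rowp 0))) schur_extZ x0.
Qed.

End Linear.

Lemma hall_sum I (r : seq I) (c : I -> R) (nu : I -> intpart) F :
  hall (\sum_(i <- r) c i *: schur R (nu i)) F =
  \sum_(i <- r) c i * schur_scoord F (nu i).
Proof.
apply: (schur_ext_sum (x := fun lam c => c * schur_scoord F lam)) => lam c1 c2.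
by rewrite mulrDl.
Qed.

(** Pairing f - f' with G_mu gives its coordinate at mu plus multiples of coordinates at strictly
    larger partitions, so the coordinates vanish by descending induction on size. *)
Lemma is_g_unique a b lam f f' : is_g a b lam f -> is_g a b lam f' -> f = f'.
Proof.
move=> gf gf'; pose c mu := schur_coord f mu - schur_coord f' mu.
pose S := (finsupp (schur_coord f) `|` finsupp (schur_coord f'))%fset.
have hallE mu :
    \sum_(nu <- S) c nu * schur_scoord (G (- a) (- b) mu) nu = 0.
  have := gf mu; rewrite -(gf' mu) /hall.
  rewrite !(@big_finsupp _ _ (fun nu d => d * schur_scoord (G (- a) (- b) mu) nu) _ S)
    ?fsubsetUl ?fsubsetUr //; try by move=> nu; rewrite mul0r.
  move=> /eqP; rewrite -subr_eq0 -sumrB => /eqP eq0; rewrite -[RHS]eq0.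
  by apply: eq_bigr => nu _; rewrite mulrBl.
have cS nu : nu \notin S -> c nu = 0.
  by rewrite !inE negb_or /c => /andP[n1 n2]; rewrite !fsfun_dflt ?subrr.
(* Sizes from [D] on lie outside the support; [k] counts the steps down from there. *)
pose D := (\max_(nu <- S) sumn nu).+1.
have c0 k mu : (D <= sumn mu + k)%N -> c mu = 0.
  elim: k mu => [|k IHk] mu.
    rewrite addn0 => lt_D; apply: cS; apply: contraL lt_D => muS.
    by rewrite -ltnNge ltnS (big_rem mu) //= leq_maxl.
  move=> le_D; have [muS|] := boolP (mu \in S); last exact: cS.
  have := hallE mu; rewrite (big_fsetD1 mu) //= scoordG_diag mulr1.
  rewrite big_seq big1 ?addr0 // => nu; rewrite !inE => /andP[neq_nu _].
  have [->|nz] := eqVneq (schur_scoord (G (- a) (- b) mu) nu) 0; first by rewrite mulr0.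
  have := contained_sumn (scoordG_contained nz); rewrite eq_sym => /(_ neq_nu) lt_nu.
  by rewrite IHk ?mul0r //; lia.
rewrite [f]schur_coordP [f']schur_coordP; congr schur_sum; apply/fsfunP => mu.
by apply/eqP; rewrite -subr_eq0; apply/eqP/(c0 D); rewrite leq_addl.
Qed.

Lemma gE a b lam f : is_g a b lam f -> g a b lam = f.
Proof.
move=> gf; apply: (@is_g_unique a b lam) (gf).
exact: epsilon_spec (inhabits 0) _ (ex_intro _ _ gf).
Qed.

(* For k = 0 this is the Schur function of nu 0. *)
Definition binom_sum (nu : nat -> intpart) (a : R) k : symfun R :=
  \sum_(i < k.+1) ('C(k.-1, k - i)%:R * a ^+ (k - i)) *: schur R (nu i).

Lemma hall_binom_sum nu a k F : hall (binom_sum nu a k) F =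
  \sum_(j < k.+1) 'C(k.-1, j)%:R * a ^+ j * schur_scoord F (nu (k - j)%N).
Proof.
rewrite hall_sum (reindex_inj rev_ord_inj) /=; apply: eq_bigr => j _.
by rewrite subSS subKn // -ltnS.
Qed.

Lemma scoordG_empty a b mu :
  schur_scoord (G a b mu) (rowp 0) = (rowp 0 == mu)%:R :> R.
Proof.
have [<-|neq] := eqVneq; first exact: scoordG_diag.
apply: contraNeq neq => /scoordG_contained contained; apply/eqP/intpart_eq => i.
by apply/eqP; rewrite /= nth_nil eq_sym -leqn0; have := contained i; rewrite /= nth_nil.
Qed.

Lemma colp0 : colp 0 = rowp 0. Proof. exact: val_inj. Qed.

Lemma binom_sum0_is_g a b c nu : nu 0%N = rowp 0 -> is_g a b (rowp 0) (binom_sum nu c 0).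
Proof.
move=> nu0 mu; rewrite hall_binom_sum big_ord1 bin0 expr0 !mul1r subnn nu0.
exact: scoordG_empty.
Qed.

Lemma coef_1DZX_exp (c : R) k j : ((1 + c *: 'X) ^+ k)`_j = 'C(k, j)%:R * c ^+ j.
Proof.
rewrite exprDn coef_sum.
under eq_bigr => i _ do rewrite expr1n mul1r exprZn coefMn coefZ coefXn.
have [lt_jk|le_kj] := ltnP j k.+1.
  rewrite (bigD1 (Ordinal lt_jk)) //= eqxx mulr1 big1 ?addr0 ?mulr_natl // => i neq_i.
  have -> : (j == i) = false by apply: contraNF neq_i => /eqP ji; apply/eqP/val_inj.
  by rewrite mulr0 mul0rn.
rewrite bin_small // mul0r big1 // => i _.
by rewrite gtn_eqF ?mulr0 ?mul0rn // (leq_trans _ le_kj).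
Qed.

(* The pairing is the coefficient of t^k in (1 + a t)^(k - 1) G_mu(t), since
   only one-row Schur functions survive in one variable. *)
Lemma row_is_g a b k : is_g a b (rowp k) (binom_sum rowp a k).
Proof.
case: k => [|k]; first exact: binom_sum0_is_g.
move=> mu; rewrite hall_binom_sum; have [lt1|sz1] := ltnP 1 (size mu).
  rewrite big1 => [|j _].
    by case: eqP lt1 => // <-.
  have [->|/scoordG_contained/(_ 1%N)] :=
    eqVneq (schur_scoord (G (- a) (- b) mu) (rowp (k.+1 - j))) 0; first by rewrite mulr0.
  rewrite [X in (_ <= X)%N]nth_default; last by rewrite size_nseq; case: (0 < _)%N.
  by rewrite leqNgt nth_part_gt0 lt1.
rewrite (rowp_eq sz1); set m := nth 0%N mu 0.
have -> : (rowp k.+1 == rowp m) = (k.+1 == m).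
  apply/eqP/eqP => [/(congr1 (fun lam : intpart => nth 0%N lam 0))|-> //].
  by rewrite /=; case: (m).
pose u := ginv (- a) k.+1.
have mE : nth 0%N (rowp m) 0 = m by rewrite /=; case: (m).
have sz_row r : (size (rowp r) <= 1)%N by rewrite size_nseq; case: (0 < r)%N.
have scoordE r : (r <= k.+1)%N ->
    schur_scoord (G (- a) (- b) (rowp m)) (rowp r) = ('X^m * u ^+ m)`_r.
  move=> le_rk; have rE : nth 0%N (rowp r) 0 = r by rewrite /=; case: (r).
  have deg_r : (mdeg (edm 1 (rowp r)) <= k.+1)%N.
    by rewrite mdegE big_ord1 mnmE /ed rE subnn addn0.
  rewrite (scoordG_alt _ _ (ltn0Sn 0) (sz_row m) (sz_row r) deg_r) mcoeff_alt det_mx11.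
  rewrite mxE mnmE /ed rE subnn addn0 /Gnum /ed mE subnn addn0 !expr0 !mulr1.
  by rewrite mulrC.
transitivity (((1 + a *: 'X) ^+ k * ('X^m * u ^+ m))`_k.+1).
  rewrite coefM; apply: eq_bigr => j _.
  by rewrite coef_1DZX_exp scoordE // leq_subr.
(* For m <= k a factor (1 + a t)^(k - m) is left, whose coefficient at k + 1 - m exceeds its degree;
   for m = k + 1 the constant term 1 is read. *)
rewrite mulrCA coefXnM; case: ltngtP => [lt_km //|lt_mk|eq_km].
  have le_mk : (m <= k)%N by rewrite -ltnS.
  rewrite -{1}(subnK le_mk) exprD -mulrA -exprMn -[1 + _]opprK.
  have -> : - - (1 + a *: 'X) = 1 - (- a) *: 'X :> {poly R}.
    by rewrite opprK scaleNr opprK.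
  rewrite mulrC ginv_coef ?leq_subr // scaleNr opprK coef_1DZX_exp bin_small ?mul0r //.
  by rewrite subSn.
rewrite -eq_km subnn -horner_coef0 hornerM !horner_exp horner0_1DZX !expr1n mul1r.
by rewrite horner_coef0 ginv0 expr1n.
Qed.

(* The pairing is the determinant of a matrix of size k + 1, expanded along its
   last column, which holds the coefficients of (1 - b t)^(k - 1). *)
Lemma col_is_g b k : is_g 0 b (colp k) (binom_sum colp b k).
Proof.
case: k => [|k]; first by rewrite colp0; apply: binom_sum0_is_g; exact: colp0.
move=> mu; rewrite hall_binom_sum oppr0; have [lt_k|le_k] := ltnP k.+1 (size mu).
  rewrite big1 => [|j _].
    by case: eqP lt_k => // <-; rewrite size_colp ltnn.
  have [->|/scoordG_contained/(_ k.+1)] :=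
    eqVneq (schur_scoord (G 0 (- b) mu) (colp (k.+1 - j))) 0; first by rewrite mulr0.
  rewrite [X in (_ <= X)%N]nth_default; last by rewrite size_colp leq_subr.
  by rewrite leqNgt nth_part_gt0 lt_k.
pose v : {poly R} := 1 + (- b) *: 'X.
(* The columns of the alternant of G_mu in k + 1 variables, followed by the extra column v^k. *)
pose pp (j : nat) : {poly R} :=
  if (j < k.+1)%N then 'X^(nth 0%N mu j + (k.+1 - j.+1)) * v ^+ j else v ^+ k.
have scoordE r : (r <= k.+1)%N -> schur_scoord (G 0 (- b) mu) (colp r) =
    \det (\matrix_(i < k.+1, j < k.+1) (pp j)`_(ed (colp r) i)).
  move=> le_rk; have szr : (size (colp r) <= k.+1)%N by rewrite size_colp.
  rewrite (scoordG_alt _ _ (ltn0Sn k) le_k szr (leqnn _)) mcoeff_alt; congr (\det _).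
  apply/matrixP => i j; rewrite !mxE mnmE /pp ltn_ord; congr (polyseq _)`__.
  rewrite /ginv scale0r (bigD1 ord0) //= expr0 big1 => [|l]; last first.
    by case: l => -[|l] //= _ _; rewrite expr0n.
  by rewrite addr0 expr1n mul1r /Gnum scale0r subr0 expr1n mulr1.
(* The rows carry all exponents k + 1, ..., 0; deleting row r leaves those of (1^r) + delta. The
   cofactor signs turn the powers of -b into powers of b. *)
pose B := \matrix_(i < k.+2, j < k.+2) (pp j)`_(k.+1 - i).
transitivity (\det B).
  rewrite (expand_det_col _ ord_max) (reindex_inj rev_ord_inj) /=.
  apply: eq_bigr => j _; have le_j : (j <= k.+1)%N by rewrite -ltnS.
  rewrite mxE /= subSS subKn // /pp ltnn coef_1DZX_exp scoordE ?leq_subr //.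
  rewrite /cofactor mulrA /=; congr (_ * _).
    have -> : (-1) ^+ (j + k.+1) = (-1) ^+ (k.+1 - j) :> R.
      have -> : (j + k.+1 = (k.+1 - j) + (j + j))%N by lia.
      by rewrite exprD -[X in _ * X]signr_odd oddD addbb mulr1.
    rewrite -mulrA.
    by rewrite -exprMn mulrN1 opprK.
  congr (\det _); apply/matrixP => i l; rewrite !mxE lift_max.
  congr (_`__); rewrite /= /ed nth_nseq /bump subSS.
  by have := ltn_ord i; case: ifP; lia.
have [lt_mu|ge_mu] := ltnP (size mu) k.+1.
  have -> : (colp k.+1 == mu) = false.
    by apply/eqP => eq_mu; rewrite -eq_mu size_colp ltnn in lt_mu.
  (* Column k belongs to a zero part, so it is v^k and repeats the extra column. *)
  rewrite -det_tr.
  apply: (@determinant_alternate _ _ _ (widen_ord (leqnSn _) (ord_max : 'I_k.+1)) ord_max).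
    by rewrite -val_eqE /= neq_ltn ltnSn.
  move=> i; rewrite !mxE /pp /= ltnSn ltnn [nth 0%N mu k]nth_default //.
  by rewrite subnn addn0 expr0 mul1r.
have eq_sz : size mu = k.+1 by apply/eqP; rewrite eqn_leq le_k.
have [le1|gt1] := leqP (nth 0%N mu 0) 1.
  have mu_col : mu = colp k.+1 by rewrite -eq_sz; apply: colp_eq.
  have nth_mu i : (i < k.+1)%N -> nth 0%N mu i = 1%N.
    by move=> lt_i; rewrite mu_col nth_nseq lt_i.
  rewrite mu_col eqxx -det_tr det_trig.
    rewrite big1 // => i _; rewrite !mxE /pp; case: ltnP => [lt_i|ge_i].
      rewrite nth_mu // coefXnM.
      have -> : (1 + (k.+1 - i.+1) = k.+1 - i)%N by lia.
      by rewrite ltnn subnn -horner_coef0 horner_exp horner0_1DZX expr1n.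
    have -> : (k.+1 - i = 0)%N by lia.
    by rewrite -horner_coef0 horner_exp horner0_1DZX expr1n.
  apply/is_trig_mxP => i j lt_ij; rewrite !mxE /pp.
  have lt_i : (i < k.+1)%N by have := ltn_ord j; lia.
  rewrite lt_i nth_mu // coefXnM.
  by have -> : (k.+1 - j < 1 + (k.+1 - i.+1))%N by lia.
have -> : (colp k.+1 == mu) = false.
  by apply/eqP => eq_mu; rewrite -eq_mu /= in gt1.
(* The first part is at least 2, so column 0 is a power of t beyond the largest exponent k + 1. *)
rewrite (expand_det_col _ ord0) big1 // => i _.
rewrite mxE /pp /= expr0 mulr1 coefXn.
have -> : (k.+1 - i == nth 0 mu 0 + (k.+1 - 1))%N = false by lia.
by rewrite mul0r.
Qed.

End Duality.

(** * Generators *)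

Section Generators.

Variables (R : idomainType) (C : nat -> symfun R).

Local Notation mevalC N := (mmap (in_alg (symfun R)) (fun i : 'I_N => C i.+1)).

Definition gen (f : symfun R) := exists (N : nat) (P : {mpoly R[N]}), f = mevalC N P.

Lemma gen_widen N M (P : {mpoly R[N]}) : (N <= M)%N ->
  exists Q : {mpoly R[M]}, mevalC N P = mevalC M Q.
Proof.
move=> le_NM; exists (mmap (@mpolyC M R) (fun i => 'X_(widen_ord le_NM i)) P).
rewrite {1}/mmap [mmap (@mpolyC M R) _ P]/mmap rmorph_sum; apply: eq_bigr => m _.
rewrite rmorphM /= mmapC; congr (_ * _).
rewrite /mmap1 rmorph_prod; apply: eq_bigr => i _.
by rewrite rmorphXn /= mmapX mmap1U.
Qed.

Lemma gen_pair f f' : gen f -> gen f' -> exists (N : nat) (P Q : {mpoly R[N]}),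
  f = mevalC N P /\ f' = mevalC N Q.
Proof.
move=> [N [P ->]] [M [Q ->]].
have [P' ->] := gen_widen P (leq_maxl N M).
have [Q' ->] := gen_widen Q (leq_maxr N M).
by exists (maxn N M), P', Q'.
Qed.

Lemma genD f f' : gen f -> gen f' -> gen (f + f').
Proof.
by move=> gf /(gen_pair gf)[N [P [Q [-> ->]]]]; exists N, (P + Q); rewrite mmapD.
Qed.

Lemma genM f f' : gen f -> gen f' -> gen (f * f').
Proof.
by move=> gf /(gen_pair gf)[N [P [Q [-> ->]]]]; exists N, (P * Q); rewrite rmorphM.
Qed.

Lemma gen_alg c : gen c%:A.
Proof. by exists 0%N, (c%:MP); rewrite mmapC. Qed.

Lemma gen1 : gen 1. Proof. by rewrite -[1]scale1r; apply: gen_alg. Qed.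

Lemma gen0 : gen 0. Proof. by rewrite -(scale0r 1); apply: gen_alg. Qed.

Lemma genZ c f : gen f -> gen (c *: f).
Proof. by rewrite -[f]mul1r scalerAl => gf; apply: genM (gen_alg c) _; rewrite mul1r in gf *. Qed.

Lemma gen_C k : (0 < k)%N -> gen (C k).
Proof.
by case: k => // k _; exists k.+1, ('X_ord_max); rewrite mmapX mmap1U.
Qed.

Lemma gen_sum I (r : seq I) (F : I -> symfun R) :
  (forall i, gen (F i)) -> gen (\sum_(i <- r) F i).
Proof. by move=> gF; apply: big_ind => //; [apply: gen0 | apply: genD]. Qed.

Lemma gen_prod I (r : seq I) (F : I -> symfun R) :
  (forall i, gen (F i)) -> gen (\prod_(i <- r) F i).
Proof. by move=> gF; apply: big_ind => //; [apply: gen1 | apply: genM]. Qed.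

Lemma generators_hsf : (forall k, gen (hsf R k)) -> generators C.
Proof.
move=> gen_h f; rewrite -/(gen f) (schur_coordP f); apply: gen_sum => lam.
apply: genZ; rewrite schurE /JT; apply: gen_sum => s; apply: genM.
  by rewrite -signr_odd; case: odd; rewrite ?expr0 ?expr1 -?scaleN1r;
    [apply: genZ|]; apply: gen1.
apply: gen_prod => i; rewrite mxE /hsub; case: ifP => _ //; exact: gen0.
Qed.

Lemma generators_unitri (q : nat -> nat -> R) :
  (forall k, (0 < k)%N -> C k = hsf R k + \sum_(i < k) q k i *: hsf R i) ->
  generators C.
Proof.
move=> CE; apply: generators_hsf; elim/ltn_ind => -[|k] IHk; first exact: gen1.
have -> : hsf R k.+1 = C k.+1 + (-1) *: \sum_(i < k.+1) q k.+1 i *: hsf R i.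
  by rewrite CE // scaleN1r addrK.
apply: genD; first exact: gen_C.
by apply: genZ; apply: gen_sum => i; apply: genZ; apply: IHk.
Qed.

End Generators.

(** * The canonical generators *)

Lemma swapE p : swap p = msym (tperm 0 1) p.
Proof.
rewrite [p in LHS]mpolyE [p in RHS]mpolyE /swap !raddf_sum; apply: eq_bigr => m _ /=.
rewrite comp_mpolyZ msymZ comp_mpolyX msymX tpermV; congr (_ *: _).
rewrite [RHS]mpolyXE_id !big_ord_recl !big_ord0 !mulr1 !mnmE.
rewrite !(tnth_nth 0) /= mulrC /al /be.
have e1 : lift ord0 ord0 = 1 :> 'I_2 by apply: val_inj.
by rewrite e1 tpermL tpermR.
Qed.

Lemma swap_binom n k : swap (n%:R * al ^+ k) = n%:R * be ^+ k.
Proof.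
by rewrite /swap rmorphM rmorph_nat rmorphXn /= comp_mpolyXU.
Qed.

(** A monomial of p and its mirror image in [swap p] would satisfy opposite strict inequalities. *)
Lemma al_gt_be_swap_eq0 p : al_gt_be p -> al_gt_be (swap p) -> p = 0.
Proof.
move=> gt_p gt_sp; apply/mpolyP => m; rewrite mcoeff0.
apply: contraTeq isT => nz; have mp : m \in msupp p by rewrite mcoeff_msupp.
pose s : 'S_2 := tperm 0 1.
have := gt_p _ mp; have := gt_sp [multinom m (s i) | i < 2].
rewrite swapE mcoeff_msupp mcoeff_sym !mnmE tpermL tpermR.
have -> : [multinom [multinom m (s i) | i < 2] (s i) | i < 2] = m.
  by apply/mnmP => i; rewrite !mnmE tpermK.
by move=> /(_ nz) lt01 lt10; have := ltn_trans lt01 lt10; rewrite ltnn.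
Qed.

Lemma al_gt_beB p q : al_gt_be p -> al_gt_be q -> al_gt_be (p - q).
Proof.
move=> gp gq m /msuppB_le; rewrite mem_cat => /orP[]; [exact: gp | exact: gq].
Qed.

Lemma al_gt_be_binom n k : (0 < k)%N -> al_gt_be (n%:R * al ^+ k).
Proof.
move=> k_gt0 m; rewrite mulr_natl -scaler_nat => /msuppZ_le.
by rewrite /al mpolyXn => /mem_msuppXP <-; rewrite !mulmnE !mnm1E mul1n.
Qed.

Lemma al_gt_be0 : al_gt_be 0.
Proof. by move=> m; rewrite msupp0. Qed.

Lemma gbeta_row k : gbeta (rowp k) = schur _ (rowp k).
Proof.
rewrite /gbeta (gE (row_is_g 0 be k)) /binom_sum big_ord_recr /= subnn bin0 expr0 mulr1 scale1r.
rewrite big1 ?add0r // => i _.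
by rewrite expr0n subn_eq0 leqNgt ltn_ord mulr0 scale0r.
Qed.

Lemma gbeta_col k : gbeta (colp k) = binom_sum colp be k.
Proof. exact: gE (col_is_g be k). Qed.

Lemma omega_bar_row n (c : 'I_n -> Zab) :
  omega (bar (\sum_(i < n) c i *: schur _ (rowp i))) =
  \sum_(i < n) swap (c i) *: schur _ (colp i).
Proof.
have -> : bar (\sum_(i < n) c i *: schur _ (rowp i)) =
    \sum_(i < n) swap (c i) *: schur _ (rowp i).
  apply: (schur_ext_sum (x := fun lam c => swap c *: schur _ lam)) => lam c1 c2.
  by rewrite /swap rmorphD scalerDl.
rewrite -[LHS]/(schur_ext (fun lam c => c *: schur _ (conjp lam)) _) schur_ext_sum.
  by apply: eq_bigr => i _; rewrite conjp_row.
by move=> lam c1 c2; rewrite scalerDl.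
Qed.

Definition rowcoef k i : Zab := 'C(k.-1, k - i)%:R * al ^+ (k - i).

Lemma g_row k : g al be (rowp k) =
  schur _ (rowp k) + \sum_(i < k) rowcoef k i *: schur _ (rowp i).
Proof.
rewrite (gE (row_is_g al be k)) /binom_sum big_ord_recr /= addrC.
by rewrite subnn bin0 expr0 mulr1 scale1r.
Qed.

Lemma omega_bar_g_row k : omega (bar (g al be (rowp k))) = gbeta (colp k).
Proof.
rewrite gbeta_col (gE (row_is_g al be k)) omega_bar_row.
by apply: eq_bigr => i _; rewrite swap_binom.
Qed.

(* Both sums lie in the span of the e_i; comparing coefficients from the top,
   d_l lies in Z[alpha > beta] and its image under the swap too. *)
Lemma col_uniqueness k (d r : nat -> Zab) :
  (forall i, (i < k)%N -> al_gt_be (d i)) -> (forall i, (i < k)%N -> al_gt_be (r i)) ->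
  \sum_(i < k) swap (d i) *: schur _ (colp i) = \sum_(i < k) r i *: gbeta (colp i) ->
  forall i, (i < k)%N -> d i = 0.
Proof.
move=> gt_d gt_r eq_dr.
have coordE l : (l < k)%N -> swap (d l) =
    \sum_(i < k) r i * schur_coord (gbeta (colp i)) (colp l).
  move=> lt_l; rewrite -schur_coord_sum -eq_dr schur_coord_sum (bigD1 (Ordinal lt_l)) //=.
  rewrite schur_coord_schur eqxx mulr1 big1 ?addr0 // => i neq_i.
  rewrite schur_coord_schur (inj_eq colp_inj) -[nat_of_ord i == l]/(i == Ordinal lt_l).
  by rewrite (negPf neq_i) mulr0.
have gcoord i l : schur_coord (gbeta (colp i)) (colp l) =
    if (l <= i)%N then 'C(i.-1, i - l)%:R * be ^+ (i - l) else 0.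
  rewrite gbeta_col schur_coord_sum -ltnS; case: ltnP => [lt_l|ge_l].
    rewrite (bigD1 (Ordinal lt_l)) //= schur_coord_schur eqxx mulr1 big1 ?addr0 // => j neq_j.
    rewrite schur_coord_schur (inj_eq colp_inj) -[nat_of_ord j == l]/(j == Ordinal lt_l).
    by rewrite (negPf neq_j) mulr0.
  rewrite big1 // => j _; rewrite schur_coord_schur (inj_eq colp_inj).
  by rewrite ltn_eqF ?mulr0 // (leq_trans (ltn_ord j)).
(* The induction must carry [r] as well: each r_i with i > l also contributes to the coefficient of
   e_l. *)
have dr0 m : forall l, (l < k)%N -> (k <= l + m)%N -> d l = 0 /\ r l = 0.
  elim: m => [|m IHm] l lt_lk; first by rewrite addn0 leqNgt lt_lk.
  move=> le_k; have swap_d : swap (d l) = r l.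
    rewrite coordE // (bigD1 (Ordinal lt_lk)) //= gcoord leqnn subnn bin0 expr0 !mulr1.
    rewrite big1 ?addr0 // => i neq_i; rewrite gcoord; case: ifP => [le_li|]; last by rewrite mulr0.
    have lt_li : (l < i)%N by rewrite ltn_neqAle le_li andbT eq_sym.
    by have [|_ ->] := IHm i (ltn_ord i); rewrite ?mul0r //; lia.
  have d0 : d l = 0.
    by apply: al_gt_be_swap_eq0; rewrite ?swap_d; [apply: gt_d | apply: gt_r].
  by split=> //; rewrite -swap_d d0 /swap rmorph0.
by move=> i lt_i; have [] := dr0 k i lt_i (leq_addl _ _).
Qed.

Theorem theorem12p3 :
  exists C : nat -> Lambda,
    [/\ canonical_generators C,
        (forall C' : nat -> Lambda, canonical_generators C' ->
           forall k : nat, (0 < k)%N -> C' k = C k) &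
        (forall k : nat, (0 < k)%N -> C k = g al be (rowp k))].
Proof.
exists (fun k => g al be (rowp k)); split=> //.
  split.
    apply: (@generators_unitri _ _ rowcoef) => k _; rewrite g_row schur_row.
    by congr (_ + _); apply: eq_bigr => i _; rewrite schur_row.
  move=> k k_gt0; split.
    exists (rowcoef k); split=> [i lt_ik|].
      by apply: al_gt_be_binom; rewrite subn_gt0.
    by rewrite g_row gbeta_row; congr (_ + _); apply: eq_bigr => i _; rewrite gbeta_row.
  exists (fun=> 0); split=> [i _|]; first exact: al_gt_be0.
  by rewrite omega_bar_g_row big1 ?addr0 // => i _; rewrite scale0r.
move=> C' [_ C'P] k k_gt0; have [[q [gt_q C'k]] [r [gt_r omC']]] := C'P k k_gt0.
have {}C'k : C' k = schur _ (rowp k) + \sum_(i < k) q i *: schur _ (rowp i).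
  by rewrite C'k gbeta_row; congr (_ + _); apply: eq_bigr => i _; rewrite gbeta_row.
have omE (c : nat -> Zab) :
    omega (bar (schur _ (rowp k) + \sum_(i < k) c i *: schur _ (rowp i))) =
    schur _ (colp k) + \sum_(i < k) swap (c i) *: schur _ (colp i).
  (* Coefficient 1 at index k makes the leading term part of the sum, as [omega_bar_row]
     requires. *)
  pose c' i : Zab := if (i < k)%N then c i else 1.
  have swap1 : swap 1 = 1 by rewrite /swap rmorph1.
  have -> : schur _ (rowp k) + \sum_(i < k) c i *: schur _ (rowp i) =
      \sum_(i < k.+1) c' i *: schur _ (rowp i).
    rewrite big_ord_recr /= /c' ltnn scale1r addrC; congr (_ + _).
    by apply: eq_bigr => i _; rewrite ltn_ord.
  rewrite omega_bar_row big_ord_recr /= /c' ltnn swap1 scale1r addrC; congr (_ + _).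
  by apply: eq_bigr => i _; rewrite ltn_ord.
have d0 : forall i, (i < k)%N -> q i - rowcoef k i = 0.
  apply: (@col_uniqueness k (fun i => q i - rowcoef k i) r) => // [i lt_ik|].
    apply: al_gt_beB (gt_q i lt_ik) _.
    by apply: al_gt_be_binom; rewrite subn_gt0.
  (* Both images have the leading term g^beta_(1^k), so subtracting leaves the swapped differences
     on the e_i against the sum of the r_i g^beta_(1^i). *)
  have := omega_bar_g_row k; rewrite g_row omE => col_k.
  move: omC'; rewrite C'k omE -col_k -addrA => /addrI/eqP.
  rewrite addrC -subr_eq -sumrB => /eqP <-; apply: eq_bigr => i _.
  by rewrite -scalerBl /swap rmorphB.
rewrite C'k g_row; congr (_ + _); apply: eq_bigr => i _.
by have /eqP := d0 i (ltn_ord i); rewrite subr_eq0 => /eqP ->.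
Qed.
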